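(* Among topologies on Fermat reals, the Euclidean topology is a best topology for pointwise convergence, in the sense of the following equivalence: for a sequence $(f_n:U\to\mathbb{R})_{n\in\mathbb{N}}$ of ordinary smooth functions defined on an open subset $U$ of $\mathbb{R}^m$, $(f_n)_{n\in\mathbb{N}}$ is pointwise Taylor convergent if and only if the sequence of Fermat extensions $({}^{\bullet}f_n:{}^{\bullet}U\to{}^{\bullet}\mathbb{R})_{n\in\mathbb{N}}$ is pointwise convergent in the Euclidean topology.
   Context: Fermat reals: for $U\subseteq\mathbb{R}^n$ open, a little-oh polynomial on $U$ is a function $x:[0,\epsilon)\to U$ ($\epsilon>0$ depending on $x$) such that $x(t)=r+\sum_{i=1}^k\alpha_i t^{a_i}+o(t)$ as $t\to0^+$ for some $k\in\mathbb{N}$, $\alpha_i\in\mathbb{R}^n$, $a_i>0$, with $r=x(0)\in U$. Two such $x,y$ are equivalent if $x(0)=y(0)$ and $x(t)-y(t)=o(t)$ as $t\to0^+$; the quotient set is ${}^{\bullet}U$. Every $x\in{}^{\bullet}U$ is uniquely of the form $x={}^{\circ}x+\sum_{i\in(0,1]_{\mathbb{R}}}\alpha_i t^{i}$ with ${}^{\circ}x\in U$ (standard part), $\alpha_i\in\mathbb{R}^n$, and all but finitely many $\alpha_i$ equal to $0$ (the quasi-decomposition of $x$); here $(0,1]_{\mathbb{R}}$ is the usual real interval. With pointwise operations ${}^{\bullet}\mathbb{R}$ is a commutative unital ring, the ring of Fermat reals. For a smooth map $f:U\to V$ between open subsets of Euclidean spaces, its Fermat extension is ${}^{\bullet}f:{}^{\bullet}U\to{}^{\bullet}V$,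 ${}^{\bullet}f([x])=[f\circ x]$. A topology on Fermat reals means an additive Hausdorff topology on ${}^{\bullet}\mathbb{R}$, i.e. a Hausdorff topology making $({}^{\bullet}\mathbb{R},+)$ a topological group (it then induces the product topology on $({}^{\bullet}\mathbb{R})^n$ for each $n\in\mathbb{N}$). A sequence of functions $g_n:A\to{}^{\bullet}\mathbb{R}$ is pointwise convergent in such a topology $\tau$ if for each $x\in A$ the sequence $(g_n(x))_n$ has a limit in ${}^{\bullet}\mathbb{R}$ with respect to $\tau$. The Euclidean topology on ${}^{\bullet}\mathbb{R}$ is the one induced by the inner product $\langle x,y\rangle={}^{\circ}x\,{}^{\circ}y+\sum_{i\in(0,1]_{\mathbb{R}}}\alpha_i\beta_i$, where $x={}^{\circ}x+\sum\alpha_i t^i$, $y={}^{\circ}y+\sum\beta_i t^i$ are quasi-decompositions. A sequence $(f_n:U\to\mathbb{R})_{n\in\mathbb{N}}$ of smooth functions on an open $U\subseteq\mathbb{R}^m$ is pointwise Taylor convergent if for every multi-index $k\in\mathbb{N}^m$ the sequence $(\partial^{|k|}f_n/\partial x^k)_{n\in\mathbb{N}}$ is pointwise convergent. $\mathbb{N}$ contains $0$. *)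

(* Defs.v *)
From HB Require Import structures.
From mathcomp Require Import all_boot all_order all_algebra.
From mathcomp Require Import generic_quotient.
From mathcomp Require Import all_classical all_reals all_analysis.
From mathcomp Require Import ring.
Set Implicit Arguments.
Unset Strict Implicit.
Unset Printing Implicit Defensive.
Import Order.TTheory GRing.Theory Num.Theory numFieldNormedType.Exports.
Local Open Scope classical_set_scope.
Local Open Scope ring_scope.
Local Open Scope quotient_scope.

Section LittleOh.
Context {R : realType} {V : normedModType R}.
Implicit Types (U : set V) (x y z : R -> V).

(* A map [0, e) -> U is represented by any extension of it to R: the values
   outside [0, e) are irrelevant here and are identified in the quotient. *)
Definition little_oh_poly U : set (R -> V) :=
  [set x | (exists2 e : R, 0 < e & forall t, 0 <= t < e -> U (x t)) /\
    exists (k : nat) (c : 'I_k -> V) (a : 'I_k -> R), (forall i, 0 < a i) /\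
      x = (fun t => x 0 + \sum_(i < k) t `^ a i *: c i) +o_ (0^'+) (@id R)].

Definition lo_equiv x y : Prop := x 0 = y 0 /\ x = y +o_ (0^'+) (@id R).

Let sml x := forall e : R, 0 < e -> \forall t \near (0 : R)^'+, `|x t| <= e * `|t|.

Let smlE x y : (x = y +o_ (0^'+) (@id R)) <-> sml (x - y).
Proof. exact: eqaddoP. Qed.

Let sml0 : sml 0.
Proof.
move=> e e0; near=> t; rewrite normr0 mulr_ge0 // ltW.
Unshelve. all: by end_near. Qed.

Let smlN x : sml x -> sml (- x).
Proof. by move=> h e /h; apply: filterS => t; rewrite normrN. Qed.

Let smlD x y : sml x -> sml y -> sml (x + y).
Proof.
move=> hx hy e e0; have e2 : 0 < e / 2 by rewrite divr_gt0.
apply: filterS2 (hx _ e2) (hy _ e2) => t h1 h2.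
rewrite (le_trans (ler_normD _ _)) // [e]splitr mulrDl; exact: lerD.
Qed.

Let smlZ (l : R) x : sml x -> sml (l *: x).
Proof.
move=> hx e e0; have l1 : 0 < `|l| + 1 by rewrite ltr_wpDl.
have e1 : 0 < e / (`|l| + 1) by rewrite divr_gt0.
apply: filterS (hx _ e1) => t h1.
rewrite [_ t]/(l *: x t) normrZ (@le_trans _ _ ((`|l| + 1) * `|x t|)) //.
  by rewrite ler_wpM2r // lerDl.
by rewrite (le_trans (ler_wpM2l (ltW l1) h1)) // mulrA mulrCA divff ?mulr1 ?gt_eqF.
Qed.

Lemma lo_equiv_refl x : lo_equiv x x.
Proof. by split=> //; apply/smlE; rewrite subrr. Qed.

Lemma lo_equiv_sym x y : lo_equiv x y -> lo_equiv y x.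
Proof. by case=> h /smlE hs; split=> //; apply/smlE; rewrite -opprB; exact: smlN. Qed.

Lemma lo_equiv_trans y x z : lo_equiv x y -> lo_equiv y z -> lo_equiv x z.
Proof.
case=> h /smlE hs [h' /smlE hs']; split; first by rewrite h.
by apply/smlE; rewrite -(subrKA y); exact: smlD.
Qed.

Lemma lo_equivD x x' y y' :
  lo_equiv x x' -> lo_equiv y y' -> lo_equiv (x + y) (x' + y').
Proof.
case=> h /smlE hs [h' /smlE hs']; split.
  by rewrite -[LHS]/(x 0 + y 0) h h'.
by apply/smlE; rewrite opprD addrACA; exact: smlD.
Qed.

Lemma lo_equivZ (l : R) x x' : lo_equiv x x' -> lo_equiv (l *: x) (l *: x').
Proof.
case=> h /smlE hs; split; first by rewrite -[LHS]/(l *: x 0) h.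
by apply/smlE; rewrite -scalerBr; exact: smlZ.
Qed.

Lemma little_oh_polyD x y : little_oh_poly setT x -> little_oh_poly setT y ->
  little_oh_poly setT (x + y).
Proof.
move=> [_ [k [c [a [a0 /smlE hx]]]]] [_ [l [d [b [b0 /smlE hy]]]]].
split; first by exists 1.
exists (k + l)%N, (fun i : 'I_(k + l) =>
    match fintype.split i with inl j => c j | inr j => d j end),
  (fun i : 'I_(k + l) =>
    match fintype.split i with inl j => a j | inr j => b j end).
split; first by move=> i; case: (fintype.split i).
apply/smlE; move: (smlD hx hy); congr sml; apply/funext => t.
rewrite -[RHS]/((x t + y t) - _) -[LHS]/((x t - _) + (y t - _)).
rewrite big_split_ord /=.
under [in RHS]eq_bigr do rewrite -[lshift _ _]/(unsplit (inl _)) unsplitK.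
under [X in _ = _ - (_ + (_ + X))]eq_bigr do
  rewrite -[rshift _ _]/(unsplit (inr _)) unsplitK.
rewrite -[(x + y) 0]/(x 0 + y 0).
by rewrite [LHS]addrACA -opprD; congr (_ - _); rewrite addrACA.
Qed.

Lemma little_oh_polyZ (l : R) x : little_oh_poly setT x ->
  little_oh_poly setT (l *: x).
Proof.
move=> [_ [k [c [a [a0 /smlE hx]]]]]; split; first by exists 1.
exists k, (fun i => l *: c i), a; split=> //.
apply/smlE; move: (smlZ l hx); congr sml; apply/funext => t.
rewrite -[RHS]/(l *: x t - (l *: x 0 + _)) -[LHS]/(l *: (x t - _)).
rewrite scalerBr scalerDr scaler_sumr.
by congr (_ - (_ + _)); apply: eq_bigr => i _; rewrite scalerA mulrC -scalerA.
Qed.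

Lemma little_oh_poly_cst (v : V) : little_oh_poly setT (cst v).
Proof.
split; first by exists 1.
exists 0, (fun=> 0), (fun=> 1); split=> //.
apply/smlE; rewrite (_ : _ - _ = 0) //; apply/funext => t.
by rewrite -[LHS]/(v - (v + _)) big_ord0 addr0 subrr.
Qed.

End LittleOh.

Section Fermat.
Context {R : realType} {V : normedModType R}.
Variable U : set V.

Definition lo_rel (x y : little_oh_poly U) : bool :=
  `[< lo_equiv (val x) (val y) >].

Let lo_rel_refl : reflexive lo_rel.
Proof. by move=> x; apply/asboolP; exact: lo_equiv_refl. Qed.

Let lo_rel_sym : symmetric lo_rel.
Proof. by move=> x y; apply/asboolP/asboolP; exact: lo_equiv_sym. Qed.

Let lo_rel_trans : transitive lo_rel.
Proof.
by move=> y x z /asboolP xy /asboolP yz; apply/asboolP; exact: lo_equiv_trans xy yz.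
Qed.

Canonical lo_equiv_rel := EquivRel lo_rel lo_rel_refl lo_rel_sym lo_rel_trans.

Definition fermat : Type := {eq_quot lo_rel}.
HB.instance Definition _ := EqQuotient.on fermat.
HB.instance Definition _ := Choice.on fermat.

Definition frep (X : fermat) : R -> V := val (repr X).

Lemma frepP X : little_oh_poly U (frep X).
Proof. by have := valP (repr X); rewrite inE. Qed.

End Fermat.

Definition fermat_real (R : realType) : Type := fermat [set: R].
HB.instance Definition _ (R : realType) := Choice.on (fermat_real R).

Section FermatReal.
Context {R : realType}.
Implicit Types (X Y Z : fermat_real R) (x y : R -> R).

(* The class of x, with the junk value 0 if x is not a little-oh polynomial *)
Definition fclass x : fermat_real R :=
  \pi_(fermat [set: R]) (insubd (exist _ (cst 0) (mem_set (little_oh_poly_cst 0))) x).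

Lemma fclassK x : little_oh_poly setT x -> lo_equiv (frep (fclass x)) x.
Proof.
move=> hx; rewrite /frep /fclass; case: piP => z /eqmodP/asboolP/lo_equiv_sym.
by rewrite val_insubd mem_set.
Qed.

Lemma fclass_eq x y : little_oh_poly setT x -> little_oh_poly setT y ->
  fclass x = fclass y <-> lo_equiv x y.
Proof.
move=> hx hy; split=> [e|h].
  apply: lo_equiv_trans (fclassK hy); rewrite -e; exact/lo_equiv_sym/fclassK.
by apply/eqmodP/asboolP; rewrite !val_insubd !mem_set.
Qed.

Lemma frepK X : fclass (frep X) = X.
Proof.
rewrite -[RHS](reprK (X : fermat _)); congr (\pi_(_) _); apply/val_inj.
by rewrite val_insubd mem_set //; exact: frepP.
Qed.

Lemma fermat_real_eq X Y : lo_equiv (frep X) (frep Y) -> X = Y.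
Proof. by move=> h; rewrite -[X]frepK -[Y]frepK; apply/fclass_eq => //; exact: frepP. Qed.

Definition fadd X Y : fermat_real R := fclass (frep X + frep Y).
Definition fscale (l : R) X : fermat_real R := fclass (l *: (frep X : R -> R^o)).

Lemma frepD X Y : lo_equiv (frep (fadd X Y)) (frep X + frep Y).
Proof. by apply: fclassK; apply: little_oh_polyD; exact: frepP. Qed.

Lemma frepZ l X : lo_equiv (frep (fscale l X)) (l *: (frep X : R -> R^o)).
Proof. by apply: fclassK; apply: little_oh_polyZ; exact: frepP. Qed.

Lemma frep0 : lo_equiv (frep (fclass 0)) 0.
Proof. exact/fclassK/little_oh_poly_cst. Qed.

Let faddA : associative fadd.
Proof.
move=> X Y Z; apply: fermat_real_eq.
apply: lo_equiv_trans (frepD _ _) _.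
apply: lo_equiv_trans (lo_equivD (lo_equiv_refl _) (frepD _ _)) _.
rewrite addrA; apply: lo_equiv_sym.
apply: lo_equiv_trans (frepD _ _) _.
exact: (lo_equivD (frepD _ _) (lo_equiv_refl _)).
Qed.

Let faddC : commutative fadd.
Proof. by move=> X Y; rewrite /fadd addrC. Qed.

Let fadd0 : left_id (fclass 0) fadd.
Proof.
move=> X; apply: fermat_real_eq; apply: lo_equiv_trans (frepD _ _) _.
by have := lo_equivD frep0 (lo_equiv_refl (frep X)); rewrite add0r.
Qed.

Let faddN : left_inverse (fclass 0) (fscale (-1)) fadd.
Proof.
move=> X; apply: fermat_real_eq; apply: lo_equiv_trans (frepD _ _) _.
have := lo_equivD (frepZ (-1) X) (lo_equiv_refl (frep X)).
rewrite scaleN1r addNr => h; apply: lo_equiv_trans h _.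
exact/lo_equiv_sym/frep0.
Qed.

HB.instance Definition _ :=
  GRing.isZmodule.Build (fermat_real R) faddA faddC fadd0 faddN.

Let fscaleA l m X : fscale l (fscale m X) = fscale (l * m) X.
Proof.
apply: fermat_real_eq; apply: lo_equiv_trans (frepZ _ _) _.
apply: lo_equiv_trans (lo_equivZ l (frepZ m X)) _.
by rewrite scalerA; exact/lo_equiv_sym/frepZ.
Qed.

Let fscale1 : left_id 1 fscale.
Proof. by move=> X; rewrite /fscale scale1r frepK. Qed.

Let fscaleDr : right_distributive fscale +%R.
Proof.
move=> l X Y; apply: fermat_real_eq; apply: lo_equiv_trans (frepZ _ _) _.
apply: lo_equiv_trans (lo_equivZ l (frepD X Y)) _.
rewrite scalerDr; apply/lo_equiv_sym; apply: lo_equiv_trans (frepD _ _) _.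
exact: lo_equivD (frepZ _ _) (frepZ _ _).
Qed.

Let fscaleDl X : {morph fscale^~ X : l m / l + m}.
Proof.
move=> l m; apply: fermat_real_eq; apply: lo_equiv_trans (frepZ _ _) _.
rewrite scalerDl; apply/lo_equiv_sym; apply: lo_equiv_trans (frepD _ _) _.
exact: lo_equivD (frepZ _ _) (frepZ _ _).
Qed.

HB.instance Definition _ := GRing.Zmodule_isLmodule.Build R (fermat_real R)
  fscaleA fscale1 fscaleDr fscaleDl.

End FermatReal.

Section QuasiDecomposition.
Context {R : realType}.
Implicit Types (X Y Z : fermat_real R) (x y : R -> R) (p q : R * (R -> R)).

Definition quasi_sum p : R -> R :=
  fun t => p.1 + \sum_(i \in `]0, 1]) p.2 i * t `^ i.

(* With p = (r, alpha), the class of x is r + sum_(0 < i <= 1) alpha_i t^i *)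
Definition quasi_decomp x p : Prop :=
  [/\ finite_set [set i | p.2 i != 0],
      forall i, p.2 i != 0 -> 0 < i <= 1 &
      lo_equiv x (quasi_sum p)].

Lemma fsumrD (A S : set R) (F G : R -> R) : finite_set S ->
  (forall i, ~ S i -> F i = 0) -> (forall i, ~ S i -> G i = 0) ->
  \sum_(i \in A) (F i + G i) = \sum_(i \in A) F i + \sum_(i \in A) G i.
Proof.
move=> Sf F0 G0.
have h (H : R -> R) : (forall i, ~ S i -> H i = 0) ->
    \sum_(i \in A) H i = \sum_(i \in A `&` S) H i.
  move=> H0; apply/esym/fsbig_widen; first exact: subIsetl.
  by move=> i [Ai nASi]; apply: H0 => Si; apply: nASi.
rewrite !h // ?fsbig_split //; first exact: finite_setIr.
by move=> i Si; rewrite F0 // G0 // addr0.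
Qed.

Lemma quasi_decomp_equiv x y p : lo_equiv x y -> quasi_decomp y p -> quasi_decomp x p.
Proof. by move=> xy [? ? h]; split=> //; exact: lo_equiv_trans h. Qed.

Lemma quasi_decompD x y p q : quasi_decomp x p -> quasi_decomp y q ->
  quasi_decomp (x + y) (p + q).
Proof.
move=> [pf ps hp] [qf qs hq].
have sub i : (p.2 + q.2) i != 0 -> p.2 i != 0 \/ q.2 i != 0.
  rewrite -[(p.2 + q.2) i]/(p.2 i + q.2 i).
  by have [->|?] := eqVneq (p.2 i) 0; [rewrite add0r; right|left].
split.
- apply: (@sub_finite_set _ _ ([set i | p.2 i != 0] `|` [set i | q.2 i != 0])).
    by move=> i /sub.
  by rewrite finite_setU.
- by move=> i /sub[/ps|/qs].
rewrite (_ : quasi_sum _ = quasi_sum p + quasi_sum q); first exact: lo_equivD.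
apply/funext => t; rewrite -[RHS]/(quasi_sum p t + quasi_sum q t) /quasi_sum /= addrACA.
congr (_ + _); under eq_fsbigr do rewrite mulrDl.
apply: (@fsumrD _ ([set i | p.2 i != 0] `|` [set i | q.2 i != 0])).
- by rewrite finite_setU.
- by move=> i /not_orP[/negP/negPn/eqP-> _]; rewrite mul0r.
- by move=> i /not_orP[_ /negP/negPn/eqP->]; rewrite mul0r.
Qed.

Lemma quasi_decompZ l x p : quasi_decomp x p ->
  quasi_decomp (l *: (x : R -> R^o)) (l * p.1, fun i => l * p.2 i).
Proof.
move=> [pf ps hp].
have sub i : l * p.2 i != 0 -> p.2 i != 0 by rewrite mulf_eq0 negb_or => /andP[].
split; [exact: sub_finite_set pf|by move=> i /sub /ps|].
rewrite (_ : quasi_sum _ = l *: (quasi_sum p : R -> R^o)); first exact: lo_equivZ.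
apply/funext => t; rewrite -[RHS]/(l * quasi_sum p t) /quasi_sum /= mulrDr mulr_fsumr.
by congr (_ + _); apply: eq_fsbigr => i _; rewrite mulrA.
Qed.

Lemma quasi_decomp_cst (r : R) : quasi_decomp (cst r) (r, cst 0).
Proof.
split=> /=; first by rewrite (_ : [set _ | _] = set0) // -subset0 => i /=; rewrite eqxx.
  by move=> i; rewrite eqxx.
rewrite (_ : quasi_sum _ = cst r); first exact: lo_equiv_refl.
by apply/funext => t; rewrite /quasi_sum /= fsbig1 ?addr0 // => i _; rewrite mul0r.
Qed.

Lemma quasi_decomp_powR (a c : R) : 0 < a ->
  exists p, quasi_decomp (fun t => t `^ a * c) p.
Proof.
move=> a0; have [a1|a1] := leP a 1.
  exists (0, fun i => if i == a then c else 0); split=> /=.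
  - apply: (@sub_finite_set _ _ [set a]); last exact: finite_set1.
    by move=> i /=; have [->//|] := eqVneq i a; rewrite eqxx.
  - by move=> i; have [->|] := eqVneq i a; rewrite ?eqxx // a0 a1.
  rewrite (_ : quasi_sum _ = fun t => t `^ a * c); first exact: lo_equiv_refl.
  apply/funext => t; rewrite /quasi_sum /= add0r.
  rewrite -(fsbig_widen [set a]).
  - by rewrite fsbig_set1 eqxx mulrC.
  - by move=> i /= ->; rewrite in_itv /= a0 a1.
  - by move=> i [_ /= ia]; case: eqP => // _; rewrite mul0r.
exists (0, cst 0); apply: quasi_decomp_equiv (quasi_decomp_cst 0); split.
  by rewrite powR0 ?mul0r ?gt_eqF.
apply/eqaddoP => e e0.
have a10 : 0 < a - 1 by rewrite subr_gt0.
have /cvgrPdist_lt := powR_cvg0 a10.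
have e1 : 0 < e / (`|c| + 1) by rewrite divr_gt0 // ltr_wpDl.
move=> /(_ _ e1) h; near=> t.
have t0 : 0 < t by near: t; exact: nbhs_right_gt.
rewrite -[_ t]/(t `^ a * c - 0) subr0 normrM -(@mulr_powRB1 _ t a (ltW t0) a0).
rewrite normrM -mulrA mulrC ler_wpM2r //.
have : `|0 - t `^ (a - 1)| < e / (`|c| + 1) by near: t.
rewrite sub0r normrN => /ltW /(ler_wpM2r (normr_ge0 c)) h1.
apply: (le_trans h1); rewrite mulrAC ler_pdivrMr ?ltr_wpDl //.
by rewrite ler_wpM2l ?(ltW e0) // lerDl.
Unshelve. all: by end_near. Qed.

Lemma quasi_decomp_ex X : exists p, quasi_decomp (frep X) p.
Proof.
have [_ [k [c [a [a0 hx]]]]] := frepP X.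
pose y := cst (frep X 0) + \sum_(i < k) (fun t => t `^ a i * c i).
have yE t : y t = frep X 0 + \sum_(i < k) t `^ a i *: c i.
  by rewrite /y fct_sumE.
have Xy : lo_equiv (frep X) y.
  split; first by rewrite yE big1 ?addr0 // => i _; rewrite powR0 ?scale0r ?gt_eqF.
  by rewrite (funext yE).
suff [p hp] : exists p, quasi_decomp y p by exists p; exact: quasi_decomp_equiv Xy hp.
suff [p hp] : exists p, quasi_decomp (\sum_(i < k) (fun t => t `^ a i * c i)) p.
  by exists ((frep X 0, cst 0) + p); exact: quasi_decompD (quasi_decomp_cst _) hp.
elim/big_rec: _ => [|i z _ [p hp]]; first by exists (0, cst 0); exact: quasi_decomp_cst.
by have [q hq] := quasi_decomp_powR (c i) (a0 i); exists (q + p); exact: quasi_decompD.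
Qed.

(* A combination of powers of t with exponents in ]0, 1] is o(t) only if it
   vanishes. *)
Lemma powR_indep (s : seq R) (g : R -> R) : sorted <%R s ->
  (forall i, i \in s -> 0 < i <= 1) ->
  (forall e : R, 0 < e ->
    \forall t \near (0 : R)^'+, `|\sum_(i <- s) g i * t `^ i| <= e * t) ->
  forall i, i \in s -> g i = 0.
Proof.
elim: s => // i0 s IH /= s_sorted s01 gs.
have lts i : i \in s -> i0 < i.
  by move=> si; have /allP := order_path_min lt_trans s_sorted; apply.
have /andP[i00 i01] := s01 _ (mem_head _ _).
have g0 : g i0 = 0.
  apply/eqP; rewrite -normr_le0; apply/ler_addgt0Pr => _/posnumP[e]; rewrite add0r.
  have e2 : 0 < e%:num / 2 :> R by [].
  have cv0 u : {subset u <= s} ->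
      (\sum_(i <- u) g i * t `^ (i - i0)) @[t --> 0^'+] --> (0 : R).
    elim: u => [|j u IHu] su.
      by under eq_fun do rewrite big_nil; exact: cvg_cst.
    under eq_fun do rewrite big_cons.
    have cj : t `^ (j - i0) @[t --> (0 : R)^'+] --> (0 : R).
      by apply: powR_cvg0; rewrite subr_gt0; apply/lts/su/mem_head.
    have cu := IHu (fun i iu => su i (mem_behead (s := j :: u) iu)).
    have h := cvgD (cvgM (cvg_cst (g j)) cj) cu; rewrite mulr0 addr0 in h.
    exact: h.
  have /cvgrPdist_lt/(_ _ e2) h := cv0 s (fun _ => id).
  near (0 : R)^'+ => t.
  have t0 : 0 < t by near: t; exact: nbhs_right_gt.
  have t1 : t <= 1 by near: t; exact: nbhs_right_le.
  have tp : 0 < t `^ i0 by exact: powR_gt0.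
  have h1 : `|0 - \sum_(i <- s) g i * t `^ (i - i0)| < e%:num / 2 by near: t.
  have h2 : `|\sum_(i <- i0 :: s) g i * t `^ i| <= (e%:num / 2) * t.
    by near: t; exact: gs.
  have E : \sum_(i <- i0 :: s) g i * t `^ i =
      (g i0 + \sum_(i <- s) g i * t `^ (i - i0)) * t `^ i0.
    rewrite big_cons mulrDl mulr_suml; congr (_ + _); apply: eq_bigr => i _.
    by rewrite -mulrA -powRD ?subrK // (gt_eqF t0) implybT.
  have h3 : `|g i0 + \sum_(i <- s) g i * t `^ (i - i0)| <= e%:num / 2.
    move: h2; rewrite E normrM (gtr0_norm tp) => h2.
    rewrite -(ler_pM2r tp) (le_trans h2) // ler_pM2l //.
    rewrite -[leLHS](powRr1 (ltW t0)); apply: ger_powR => //.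
    by rewrite t0 t1.
  rewrite -[g i0](addrK (\sum_(i <- s) g i * t `^ (i - i0))).
  rewrite (le_trans (ler_normB _ _)) // [leRHS]splitr lerD //.
  by move: h1; rewrite sub0r normrN => /ltW.
move=> i; rewrite inE => /predU1P[->//|si].
apply: IH si; first exact: path_sorted s_sorted.
  by move=> j sj; apply: s01; rewrite inE sj orbT.
move=> e /gs; apply: filterS => t.
by rewrite big_cons g0 mul0r add0r.
Unshelve. all: by end_near. Qed.

Lemma quasi_decomp0 p : quasi_decomp 0 p -> p = (0, cst 0).
Proof.
case: p => r g [/= gf g01 [/= h0 hs]].
have r0 : r = 0.
  move: h0; rewrite /quasi_sum /= fsbig1 ?addr0 // => i /andP[i0 _].
  by rewrite powR0 ?mulr0 // gt_eqF.
congr (_, _) => //; apply/funext => i; have [//|gi] := eqVneq (g i) 0.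
have /finite_seqP[u uE] := gf; pose s := sort <=%R (undup u).
have sE j : (j \in s) = (g j != 0).
  rewrite mem_sort mem_undup; apply/idP/idP => h.
    by have : [set` u] j by []; rewrite -uE.
  by have : [set i | g i != 0] j by []; rewrite uE.
have s_uniq : uniq s by rewrite sort_uniq undup_uniq.
apply: (@powR_indep s); last by rewrite sE.
- rewrite lt_sorted_uniq_le s_uniq /=; exact/sort_sorted/le_total.
- by move=> j; rewrite sE => /g01.
move=> e e0; move/eqaddoP: hs => /(_ _ e0) hs.
near=> t.
have t0 : 0 < t by near: t; exact: nbhs_right_gt.
have : `|(0 - quasi_sum (r, g)) t| <= e * `|t| by near: t.
rewrite -[(0 - _) t]/(0 - quasi_sum (r, g) t) sub0r normrN (gtr0_norm t0).
rewrite /quasi_sum /= r0 add0r.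
suff -> : \sum_(j \in `]0, 1]) g j * t `^ j = \sum_(j <- s) g j * t `^ j by [].
rewrite [RHS]fsbig_seq //; symmetry; apply: fsbig_widen.
  by move=> j; rewrite /= sE => /g01.
by move=> j [_ /= /negP]; rewrite sE negbK => /eqP ->; rewrite mul0r.
Unshelve. all: by end_near. Qed.

Lemma quasi_decomp_uniq x p q : quasi_decomp x p -> quasi_decomp x q -> p = q.
Proof.
move=> hp /(quasi_decompZ (-1)) hq.
have := quasi_decompD hp hq; rewrite scaleN1r subrr => /quasi_decomp0.
case: p q {hp hq} => [r g] [s h] [/eqP + gh].
rewrite mulN1r subr_eq0 => /eqP ->; congr (_, _); apply/funext => i.
have /eqP := congr1 (fun f => f i) gh.
by rewrite -[X in X == _]/(g i + -1 * h i) mulN1r subr_eq0 => /eqP.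
Qed.

(* (standard part, coefficients) *)
Definition qdec X : R * (R -> R) := xget (0, cst 0) (quasi_decomp (frep X)).

Lemma qdecP X : quasi_decomp (frep X) (qdec X).
Proof. by have [p hp] := quasi_decomp_ex X; rewrite /qdec; case: xgetP => [q -> //|/(_ p)]. Qed.

Lemma qdec_eq X p : quasi_decomp (frep X) p -> qdec X = p.
Proof. exact/quasi_decomp_uniq/qdecP. Qed.

Lemma qdecD X Y : qdec (X + Y) = qdec X + qdec Y.
Proof.
apply: qdec_eq; apply: quasi_decomp_equiv (frepD X Y) _.
exact: quasi_decompD (qdecP X) (qdecP Y).
Qed.

Lemma qdecZ l X : qdec (l *: X) = (l * (qdec X).1, fun i => l * (qdec X).2 i).
Proof.
apply: qdec_eq; apply: quasi_decomp_equiv (frepZ l X) _.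
exact: quasi_decompZ (qdecP X).
Qed.

Lemma qdec_inj X : qdec X = (0, cst 0) -> X = 0.
Proof.
move=> h; apply: fermat_real_eq; apply: lo_equiv_trans (lo_equiv_sym frep0).
have [_ _] := qdecP X; rewrite h (_ : quasi_sum _ = 0) //.
by apply/funext => t; rewrite /quasi_sum /= fsbig1 ?addr0 // => i _; rewrite mul0r.
Qed.

Definition fermat_inner X Y : R :=
  (qdec X).1 * (qdec Y).1 + \sum_(i \in `]0, 1]) (qdec X).2 i * (qdec Y).2 i.

Lemma fermat_innerC X Y : fermat_inner X Y = fermat_inner Y X.
Proof.
by rewrite /fermat_inner mulrC; congr (_ + _); apply: eq_fsbigr => i _; rewrite mulrC.
Qed.

Lemma fermat_innerDl X Y Z :
  fermat_inner (X + Y) Z = fermat_inner X Z + fermat_inner Y Z.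
Proof.
rewrite /fermat_inner qdecD /= mulrDl addrACA; congr (_ + _).
under eq_fsbigr do rewrite mulrDl.
have [fZ _ _] := qdecP Z.
by apply: (fsumrD _ fZ) => i /= /negP; rewrite negbK => /eqP ->; rewrite mulr0.
Qed.

Lemma fermat_innerZl l X Y : fermat_inner (l *: X) Y = l * fermat_inner X Y.
Proof.
rewrite /fermat_inner qdecZ /= mulrDr mulrA mulr_fsumr; congr (_ + _).
by apply: eq_fsbigr => i _; rewrite mulrA.
Qed.

Lemma fermat_inner_ge0 X : 0 <= fermat_inner X X.
Proof.
rewrite addr_ge0 // -?expr2 ?sqr_ge0 //.
by apply: fsumr_ge0 => i _; rewrite -expr2 sqr_ge0.
Qed.

Lemma fermat_inner_eq0 X : fermat_inner X X = 0 -> X = 0.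
Proof.
move=> /eqP; rewrite /fermat_inner paddr_eq0; last first.
- by apply: fsumr_ge0 => i _; rewrite -expr2 sqr_ge0.
- by rewrite -expr2 sqr_ge0.
rewrite mulf_eq0 orbb => /andP[/eqP r0 /eqP]; have [fX sX _] := qdecP X.
rewrite -(fsbig_widen [set i | (qdec X).2 i != 0]); first last.
- by move=> i [_ /= /negP]; rewrite negbK => /eqP ->; rewrite mulr0.
- by move=> i /sX.
move=> /pfsumr_eq0 g0; apply: qdec_inj; rewrite [LHS]surjective_pairing r0.
congr (_, _); apply/funext => i /=; have [//|gi] := eqVneq ((qdec X).2 i) 0.
have /eqP := g0 fX (fun i _ => ltac:(rewrite -expr2; exact: sqr_ge0)) i gi.
by rewrite mulf_eq0 orbb => /eqP.
Qed.

Definition fermat_norm X : R := Num.sqrt (fermat_inner X X).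

Lemma fermat_cauchy_schwarz X Y : fermat_inner X Y <= fermat_norm X * fermat_norm Y.
Proof.
have [/fermat_inner_eq0 ->|Y0] := eqVneq (fermat_inner Y Y) 0.
  rewrite fermat_innerC -(scale0r X) fermat_innerZl mul0r.
  by rewrite mulr_ge0 ?sqrtr_ge0.
rewrite -sqrtrM ?fermat_inner_ge0 // (le_trans (ler_norm _)) // -sqrtr_sqr ler_wsqrtr //.
set c := fermat_inner X Y / fermat_inner Y Y.
have := fermat_inner_ge0 (X + (- c) *: Y).
rewrite fermat_innerDl ![fermat_inner _ (X + _)]fermat_innerC !fermat_innerDl.
rewrite ![fermat_inner (_ *: _) _]fermat_innerZl.
rewrite ![fermat_inner _ (_ *: _)]fermat_innerC !fermat_innerZl.
rewrite [fermat_inner Y X]fermat_innerC.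
have Yp : 0 < fermat_inner Y Y by rewrite lt_def Y0 fermat_inner_ge0.
rewrite -(ler_pM2r Yp) mul0r => h; rewrite -subr_ge0.
apply: le_trans h _; rewrite le_eqVlt; apply/orP; left; apply/eqP.
by rewrite /c; field.
Qed.

Lemma fermat_normD X Y : fermat_norm (X + Y) <= fermat_norm X + fermat_norm Y.
Proof.
rewrite -(@ler_sqr R) ?nnegrE ?addr_ge0 ?sqrtr_ge0 //.
rewrite sqrrD !sqr_sqrtr ?fermat_inner_ge0 //.
rewrite fermat_innerDl ![fermat_inner _ (X + Y)]fermat_innerC !fermat_innerDl.
rewrite [fermat_inner Y X]fermat_innerC addrA lerD2r -addrA lerD2l -mulr2n.
by rewrite lerMn2r fermat_cauchy_schwarz orbT.
Qed.

Lemma fermat_normZ l X : fermat_norm (l *: X) = `|l| * fermat_norm X.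
Proof.
rewrite /fermat_norm fermat_innerZl fermat_innerC fermat_innerZl mulrA -expr2.
by rewrite sqrtrM ?sqr_ge0 // sqrtr_sqr.
Qed.

Lemma fermat_norm_eq0 X : fermat_norm X = 0 -> X = 0.
Proof.
move/eqP; rewrite sqrtr_eq0 => h; apply/fermat_inner_eq0/eqP.
by rewrite eq_le h fermat_inner_ge0.
Qed.

End QuasiDecomposition.

(* The Fermat reals, with the topology of the norm of fermat_inner *)
Definition euclidean_fermat_real (R : realType) : Type := fermat_real R.
HB.instance Definition _ (R : realType) := GRing.Lmodule.on (euclidean_fermat_real R).
HB.instance Definition _ (R : realType) := Lmodule_isNormed.Build R
  (euclidean_fermat_real R) (@fermat_normD R) (@fermat_normZ R) (@fermat_norm_eq0 R).

(* T carries an additive group and a topology, a priori unrelated *)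
Definition additive_hausdorff (T : PreTopologicalZmodule.type) : Prop :=
  [/\ hausdorff_space T,
      continuous (fun z : T * T => z.1 + z.2) &
      continuous (fun z : T => - z)].

Definition pointwise_cvg {A : Type} (T : ptopologicalType) (D : set A)
    (g : nat -> A -> T) : Prop :=
  forall x, D x -> cvg (g n x @[n --> \oo]).
Arguments pointwise_cvg {A} T D g.

(* The class of f \o x for a representative x of X. When f is smooth on the open
   set U, f \o x is a little-oh polynomial whose class only depends on X. *)
Definition fermat_ext {R : realType} {V : normedModType R} (U : set V)
  (f : V -> R) (X : fermat U) : fermat_real R := fclass (f \o frep X).
Arguments fermat_ext {R V} U f X.

Section Smooth.
Context {R : realType} {m : nat}.
Implicit Types (U : set 'rV[R]_m) (f : 'rV[R]_m -> R).

Definition partial (i : 'I_m) f : 'rV[R]_m -> R := 'D_(delta_mx 0 i) f.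

(* Partial derivatives of all orders, taken in any order of the variables,
   exist and are continuous on U; values of f outside U are irrelevant. *)
Definition smooth U f : Prop :=
  forall (s : seq 'I_m) x, U x ->
    {for x, continuous (foldr partial f s)} /\
    forall i, derivable (foldr partial f s) x (delta_mx 0 i).

Definition multi_partial (k : 'I_m -> nat) f : 'rV[R]_m -> R :=
  foldr (fun i => iter (k i) (partial i)) f (enum 'I_m).

Definition pointwise_taylor_cvg U (f : nat -> 'rV[R]_m -> R) : Prop :=
  forall k : 'I_m -> nat, pointwise_cvg R U (fun n => multi_partial k (f n)).

End Smooth.

(* Main.v *)
(* Fix X in the Fermat extension of U, with representative x, standard part r and
   |x(t) - r| <= A t^a near 0.  Taylor's formula of order N with (N + 1) a > 1
   expresses f(x(t)), modulo o(t), as the sum over the multi-indices k in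
   {0, ..., N}^m of (d^k f)(r) times the monomial path (x(t) - r)^k / k!, which does
   not depend on f.  So the extension of f at X is a fixed finite linear
   combination of the partial derivatives of f at r, and Taylor convergence implies
   convergence in the Euclidean norm.

   Conversely, given a multi-index K, take x(t) = r + (t^(a_1), ..., t^(a_m)) with
   exponents such that the numbers sum_i k_i a_i are pairwise distinct and the one
   for K is at most 1.  Then (d^K f)(r) / K! is a single coefficient of the
   quasi-decomposition, and coefficients are continuous for the Euclidean norm.

   Taylor's formula is applied one coordinate at a time, in the order in which
   multi_partial differentiates: neither the symmetry of partial derivatives nor
   a chain rule is needed, only remainder bounds uniform in the base point. *)

Require Import Defs.
From mathcomp Require Import all_boot all_order all_algebra.
From mathcomp Require Import all_classical all_reals all_analysis.
From mathcomp Require Import ring.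
Import Order.TTheory GRing.Theory Num.Theory.
Import numFieldNormedType.Exports.
Local Open Scope classical_set_scope.
Local Open Scope ring_scope.

Set Implicit Arguments.
Unset Strict Implicit.
Unset Printing Implicit Defensive.

(** * Taylor's formula *)

Section Taylor1.
Context {R : realType}.
Implicit Types (a C x : R) (g : nat -> R -> R).

(** The mean value theorem on [0, a] or [a, 0]; the symmetric condition |x| <= |a| treats both signs
    of [a] at once. *)
Lemma MVT_norm_le (u du : R -> R) a C :
  (forall x, `|x| <= `|a| -> is_derive x 1 u (du x)) ->
  (forall x, `|x| <= `|a| -> `|du x| <= C) ->
  `|u a - u 0| <= C * `|a|.
Proof.
move=> dh hC.
have cont (i : interval R) : {subset i <= [pred x | `|x| <= `|a|]} ->
    {within [set` i], continuous u}.
  by move=> si; apply: derivable_within_continuous => x /si /dh [].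
have [a0|a0] := leP 0 a.
- have sub x : x \in `[0, a] -> `|x| <= `|a|.
    by rewrite in_itv /= => /andP[x0 xa]; rewrite !ger0_norm.
  have [||c ca ->] := @MVT_segment _ u du 0 a a0.
  + by move=> x xa; apply/dh/sub/subset_itv_oo_cc.
  + by apply: cont => x xa; exact: sub.
  by rewrite subr0 normrM ler_wpM2r //; apply/hC/sub.
- have sub x : x \in `[a, 0] -> `|x| <= `|a|.
    by rewrite in_itv /= => /andP[x0 xa]; rewrite !ler0_norm ?lerN2 // ltW.
  have [||c ca] := @MVT_segment _ u du a 0 (ltW a0).
  + by move=> x xa; apply/dh/sub/subset_itv_oo_cc.
  + by apply: cont => x xa; exact: sub.
  rewrite sub0r => E; rewrite distrC E normrM normrN ler_wpM2r //.
  exact/hC/sub.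
Qed.

(** Here [g j] plays the j-th derivative of [g 0]. By induction on [n]: the remainder vanishes at 0
    and its derivative is the remainder of the shifted family [g j.+1], so the mean value inequality
    gains one power of |a|. *)
Lemma taylor_bound (n : nat) g a C :
  (forall x j, `|x| <= `|a| -> (j <= n)%N -> is_derive x 1 (g j) (g j.+1 x)) ->
  (forall x, `|x| <= `|a| -> `|g n.+1 x| <= C) ->
  `|g 0%N a - \sum_(j < n.+1) g j 0 * (a ^+ j / j`!%:R)| <= C * `|a| ^+ n.+1.
Proof.
elim: n g a => [|n IH] g a dg hC.
  rewrite big_ord1 expr0 fact0 divr1 mulr1 expr1.
  by apply: (@MVT_norm_le _ (g 1%N)) => // x xa; exact: dg.
pose u x := g 0%N x - \sum_(j < n.+2) g j 0 * (x ^+ j / j`!%:R).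
pose du x := g 1%N x - \sum_(j < n.+1) g j.+1 0 * (x ^+ j / j`!%:R).
have dP x (j : nat) (c : R) :
    is_derive x 1 (fun x : R => c * (x ^+ j.+1 / j.+1`!%:R)) (c * (x ^+ j / j`!%:R)).
  have -> : (fun x : R => c * (x ^+ j.+1 / j.+1`!%:R)) =
      (c / j.+1`!%:R) \*: ((id : R -> R) ^+ j.+1).
    apply/funext => z; rewrite /= exprfctE -[RHS]/(c / j.+1`!%:R * z ^+ j.+1).
    by ring.
  apply: is_derive_eq.
  rewrite -[LHS]/(c / j.+1`!%:R * ((j.+1%:R * x ^+ j) * 1)) factS natrM.
  by field; rewrite nat1r !pnatr_eq0 -lt0n fact_gt0.
have u0 : u 0 = 0.
  rewrite /u big_ord_recl /= expr0 fact0 divr1 mulr1 big1 ?addr0 ?subrr //.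
  by move=> i _; rewrite /bump /= add1n expr0n /= mul0r mulr0.
rewrite -[X in `|X|]/(u a) -[u a]subr0 -u0.
have dsum x (k : nat) : is_derive x 1
    (fun x => \sum_(j < k) g j.+1 0 * (x ^+ j.+1 / j.+1`!%:R))
    (\sum_(j < k) g j.+1 0 * (x ^+ j / j`!%:R)).
  elim: k => [|k IHk].
    rewrite big_ord0; under eq_fun do rewrite big_ord0; exact: is_derive_cst.
  rewrite big_ord_recr /=; under eq_fun do rewrite big_ord_recr /=.
  exact: is_deriveD.
rewrite exprSr mulrA; apply: (@MVT_norm_le u du) => x xa.
- rewrite /u /du; under eq_fun do rewrite big_ord_recl /= expr0 fact0 divr1 mulr1.
  under eq_fun do under eq_bigr do rewrite /bump /= add1n.
  apply: is_deriveB; first exact: dg.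
  rewrite -[X in is_derive _ _ _ X]add0r; apply: is_deriveD.
- apply: (le_trans (IH (fun j => g j.+1) x _ _)).
  + by move=> y j yx jn; apply: dg => //; exact: le_trans xa.
  + by move=> y yx; apply: hC; exact: le_trans xa.
  have C0 : 0 <= C by apply: le_trans (hC _ xa).
  by apply: ler_wpM2l => //; apply: lerXn2r.
Qed.

End Taylor1.

(** * Taylor's formula in several variables, one coordinate at a time *)

Section TaylorMulti.
Context {R : realType} {m : nat}.
Implicit Types (U : set 'rV[R]_m) (F f : 'rV[R]_m -> R) (i : 'I_m) (s : seq 'I_m).

Local Notation ei i := (delta_mx 0 i : 'rV[R]_m).

Lemma norm_delta_rv_le1 i : `|ei i| <= 1.
Proof.
rewrite [leLHS]mx_normrE; apply/bigmax_leP; split=> // -[a b] _ /=.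
by rewrite mxE ger0_norm ?ler0n // lern1; case: (_ && _).
Qed.

Lemma normr_coord_le (v : 'rV[R]_m) i : `|v 0 i| <= `|v|.
Proof.
rewrite [leRHS]mx_normrE.
exact: (le_bigmax _ (fun ij => `|v ij.1 ij.2|) (0, i)).
Qed.

Lemma smooth_foldr U F s : smooth U F -> smooth U (foldr partial F s).
Proof. by move=> sF s' x Ux; rewrite -foldr_cat; exact: sF. Qed.

Lemma iter_partialE (j : nat) i F : iter j (partial i) F = foldr partial F (nseq j i).
Proof. by elim: j => //= j ->. Qed.

Lemma eq_foldr_partial s (k k' : 'I_m -> nat) F : {in s, k =1 k'} ->
  foldr (fun i => iter (k i) (partial i)) F s =
  foldr (fun i => iter (k' i) (partial i)) F s.
Proof.
elim: s => //= i s IH kk'; rewrite kk' ?mem_head // IH // => l ls.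
by rewrite kk' // inE ls orbT.
Qed.

(** The difference quotient of the restriction to the line is literally that of [F] in the direction
    [ei i]. *)
Lemma is_derive_line F i (y : 'rV[R]_m) (a : R) : derivable F (y + a *: ei i) (ei i) ->
  is_derive a 1 (fun b => F (y + b *: ei i)) (partial i F (y + a *: ei i)).
Proof.
have E : (fun h : R => h^-1 *: (((fun b => F (y + b *: ei i)) \o shift a) (h *: 1)
      - F (y + a *: ei i))) =
    (fun h : R => h^-1 *: ((F \o shift (y + a *: ei i)) (h *: ei i)
      - F (y + a *: ei i))).
  apply/funext => h /=; congr (_ *: (F _ - _)).
  by rewrite -[h *: 1]/(h * 1) mulr1 scalerDl addrCA.
by move=> dF; split; rewrite /derivable /partial /derive E.
Qed.

(* Largeness of M stands both for a large constant and for a small neighbourhood. *)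
Lemma taylor_coord (N : nat) U F (r : 'rV[R]_m) i : open U -> U r -> smooth U F ->
  \forall M \near +oo, forall (y : 'rV[R]_m) (a : R),
    `|y - r| <= M^-1 -> `|a| <= M^-1 ->
    `|F (y + a *: ei i) - \sum_(j < N.+1) iter j (partial i) F y * (a ^+ j / j`!%:R)|
      <= M * `|a| ^+ N.+1.
Proof.
move=> oU Ur sF; set G := iter N.+1 (partial i) F.
have Gc : {for r, continuous G} by rewrite /G iter_partialE; exact: (sF _ _ Ur).1.
have rU : \forall z \near r, U z by exact: open_nbhs_nbhs.
have GB : \forall z \near r, `|G z| <= `|G r| + 1.
  by apply: cvgr_norm_le Gc _ _; rewrite ltrDl.
have /nbhs_normP[d /= d0 hd] : \forall z \near r, U z /\ `|G z| <= `|G r| + 1.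
  by near=> z; split; near: z.
near=> M => y a yr aM.
have M0 : 0 < M by near: M; apply: nbhs_pinfty_gt; exact: num_real.
(* Half of [d] is spent on the distance from [y] to [r], the other half on the increment along
   [ei i]. *)
have Md : M^-1 < d / 2.
  rewrite -[ltRHS]invrK ltf_pV2 ?posrE ?invr_gt0 ?divr_gt0 //.
  by near: M; apply: nbhs_pinfty_gt; exact: num_real.
have MG : `|G r| + 1 <= M by near: M; apply: nbhs_pinfty_ge; exact: num_real.
have inball x : `|x| <= `|a| -> U (y + x *: ei i) /\ `|G (y + x *: ei i)| <= M.
  move=> xa; have [] := hd (y + x *: ei i); last by move=> Uz Gz; split=> //; exact: le_trans MG.
  rewrite /= distrC addrAC (le_lt_trans (ler_normD _ _)) // [ltRHS]splitr ltrD //.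
    exact: le_lt_trans Md.
  rewrite normrZ (le_lt_trans _ Md) // (le_trans _ aM) // -[leRHS]mulr1.
  by rewrite ler_pM ?normr_ge0 // norm_delta_rv_le1.
pose g j (b : R) := iter j (partial i) F (y + b *: ei i).
have := @taylor_bound R N g a M.
rewrite /g /= scale0r addr0; apply.
- move=> x j xa jN; apply: is_derive_line.
  by rewrite iter_partialE; apply: (sF _ _ _).2; have [] := inball _ xa.
- by move=> x /inball[].
Unshelve. all: by end_near. Qed.

(** Multi-indices on a subset of the variables are encoded as functions on all of them that vanish
    elsewhere, so that the index type stays fixed during the induction on [s]. *)
Definition supported N (s : seq 'I_m) (k : {ffun 'I_m -> 'I_N.+1}) :=
  [forall i, (i \notin s) ==> (k i == ord0)].

(** A multi-index supported in [i :: s] amounts to one supported in [s] together with its value [j]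
    at [i]. The inverse map resets the entry at [i] to 0, which is its only possible value when [i]
    is not in [s]. *)
Lemma sum_supported_cons (V : nmodType) N i s (G : {ffun 'I_m -> 'I_N.+1} -> V) :
  i \notin s ->
  \sum_(k | supported (i :: s) k) G k =
  \sum_(k | supported s k) \sum_j G [ffun l => if l == i then j else k l].
Proof.
move=> si; rewrite pair_big_dep /=.
rewrite (reindex_onto
  (fun p : {ffun 'I_m -> 'I_N.+1} * 'I_N.+1 => [ffun l => if l == i then p.2 else p.1 l])
  (fun k => ([ffun l => if l == i then ord0 else k l], k i))) /=; last first.
  by move=> k _; apply/ffunP => l; rewrite !ffunE; case: eqP => // ->.
apply: eq_bigl => -[k j] /=; rewrite andbT; apply/andP/idP.
- move=> [/forallP h /eqP[E _]]; apply/forallP => l; apply/implyP => ls.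
  have := h l; rewrite ffunE inE negb_or ls andbT -E !ffunE.
  by case: eqP.
- move=> /forallP h; split.
    apply/forallP => l; apply/implyP; rewrite inE negb_or ffunE => /andP[/negPf -> ls].
    by have := h l; rewrite ls.
  apply/eqP; congr (_, _); last by rewrite ffunE eqxx.
  apply/ffunP => l; rewrite !ffunE; case: eqP => // ->.
  by have := h i; rewrite si => /eqP.
Qed.

Definition multi_monom N s (k : {ffun 'I_m -> 'I_N.+1}) (h : 'I_m -> R) : R :=
  \prod_(i <- s) (h i ^+ k i / (k i)`!%:R).

(** The degree is at most [N] in each variable separately; the total degree may exceed [N]. *)
Definition multi_taylor N F s (h : 'I_m -> R) y :=
  \sum_(k : {ffun 'I_m -> 'I_N.+1} | supported s k)
    foldr (fun i => iter (k i) (partial i)) F s y * multi_monom s k h.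

(** By induction on [s]: move first to y' = y + h_i e_i and apply the induction hypothesis there,
    then expand each derivative at y' around [y] by [taylor_coord]. This is why the bounds must be
    uniform in the base point. *)
Lemma taylor_seq N U F r s : open U -> U r -> smooth U F -> uniq s ->
  \forall M \near +oo, forall (y : 'rV[R]_m) (h : 'I_m -> R) (q : R),
    `|y - r| <= M^-1 -> 0 <= q <= M^-1 -> (forall i, `|h i| <= q) ->
    `|F (y + \sum_(i <- s) h i *: ei i) - multi_taylor N F s h y| <= M * q ^+ N.+1.
Proof.
move=> oU Ur sF; elim: s => [_|i s IH /= /andP[si us]].
  (* With no variable left, the zero multi-index is the only one and the error is 0. *)
  near=> M => y h q _ /andP[q0 _] _.
  rewrite big_nil addr0 /multi_taylor (big_pred1 [ffun=> ord0]); last first.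
    move=> k; apply/forallP/eqP => [hk|-> l]; last by rewrite ffunE implybT.
    by apply/ffunP => l; rewrite ffunE; apply/eqP/hk.
  rewrite /multi_monom big_nil mulr1 /= subrr normr0.
  have M0 : 0 <= M by near: M; apply: nbhs_pinfty_ge; exact: num_real.
  by rewrite mulr_ge0 // exprn_ge0.
have [M [M1 hM hc]] : exists M : R, [/\ 1 <= M,
   forall (y : 'rV[R]_m) (h : 'I_m -> R) (q : R),
    `|y - r| <= M^-1 -> 0 <= q <= M^-1 -> (forall i, `|h i| <= q) ->
    `|F (y + \sum_(i <- s) h i *: ei i) - multi_taylor N F s h y| <= M * q ^+ N.+1 &
   forall (k : {ffun 'I_m -> 'I_N.+1}) (y : 'rV[R]_m) (a : R),
    `|y - r| <= M^-1 -> `|a| <= M^-1 ->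
    `|foldr (fun i => iter (k i) (partial i)) F s (y + a *: ei i) -
     \sum_(j < N.+1) iter j (partial i) (foldr (fun i => iter (k i) (partial i)) F s) y
       * (a ^+ j / j`!%:R)|
      <= M * `|a| ^+ N.+1].
  have sk (k : {ffun 'I_m -> 'I_N.+1}) :
      smooth U (foldr (fun i => iter (k i) (partial i)) F s).
    elim: s {IH si us} => [//|l s IHs] /=.
    by rewrite iter_partialE; exact: smooth_foldr.
  near (+oo%R : set_system R) => M; exists M; split.
  - by near: M; apply: nbhs_pinfty_ge; exact: num_real.
  - by near: M; exact: IH.
  (* There are finitely many multi-indices, so one [M] serves them all. *)
  - near: M; apply: filter_forall => k; exact: taylor_coord oU Ur (sk k).
(* The first [M] is the error of the induction hypothesis at y'; each multi-index supported in [s]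
   then costs another [M] when its derivative is expanded around [y]. *)
pose C := M + \sum_(k : {ffun 'I_m -> 'I_N.+1} | supported s k) M.
near=> M' => y h q yr /andP[q0 qM] hq.
have M0 : 0 < M by apply: lt_le_trans M1.
have CM : C <= M' by near: M'; apply: nbhs_pinfty_ge; exact: num_real.
(* The factor 1/2 keeps y' within [M^-1] of [r], where [hM] applies. *)
have MM : M'^-1 <= M^-1 / 2.
  rewrite -invfM lef_pV2 ?posrE.
  - by near: M'; apply: nbhs_pinfty_ge; exact: num_real.
  - by near: M'; apply: nbhs_pinfty_gt; exact: num_real.
  - by rewrite mulr_gt0.
have MM1 : M'^-1 <= M^-1.
  by rewrite (le_trans MM) // ler_pdivrMr // ler_peMr ?ler1n // invr_ge0 ltW.
have q1 : q <= 1.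
  by rewrite (le_trans qM) // (le_trans MM1) // invf_le1.
have hiM : `|h i| <= M'^-1 by exact: le_trans qM.
rewrite big_cons addrA.
set y' := y + h i *: ei i.
have y'r : `|y' - r| <= M^-1.
  rewrite /y' addrAC (le_trans (ler_normD _ _)) // [leRHS]splitr lerD //.
    exact: le_trans MM.
  rewrite normrZ (le_trans _ MM) // (le_trans _ hiM) // -[leRHS]mulr1.
  by rewrite ler_pM ?normr_ge0 // norm_delta_rv_le1.
rewrite -(subrKA (multi_taylor N F s h y')) (le_trans (ler_normD _ _)) //.
apply: (@le_trans _ _ (C * q ^+ N.+1)); last by rewrite ler_wpM2r // exprn_ge0.
rewrite /C mulrDl lerD //.
  by apply: hM; rewrite ?q0 // (le_trans qM).
rewrite mulr_suml /multi_taylor sum_supported_cons // -sumrB.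
rewrite (le_trans (ler_norm_sum _ _ _)) //; apply: ler_sum => k _.
have kE j : foldr (fun i0 => iter ([ffun l => if l == i then j else k l] i0) (partial i0)) F s
    = foldr (fun i => iter (k i) (partial i)) F s.
  apply: eq_foldr_partial => l ls; rewrite ffunE; case: eqP => // li.
  by rewrite -li ls in si.
have mE (j : 'I_N.+1) : multi_monom (i :: s) [ffun l => if l == i then j else k l] h =
   (h i ^+ j / j`!%:R) * multi_monom s k h.
  rewrite /multi_monom big_cons ffunE eqxx; congr (_ * _).
  apply: eq_big_seq => l ls; rewrite ffunE; case: eqP => // li.
  by rewrite -li ls in si.
under eq_bigr do rewrite /= ffunE eqxx mE kE mulrA.
rewrite -mulr_suml -mulrBl normrM -[leRHS]mulr1 ler_pM //.
- apply: (le_trans (hc k y (h i) _ _)).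
  + exact: le_trans MM1.
  + exact: le_trans MM1.
  + by rewrite ler_pM2l // lerXn2r.
(* Since |h_l| <= q <= 1, each factor of the monomial is at most 1 in absolute value. *)
- rewrite /multi_monom normr_prod numdomain.Num.Theory.prodr_ile1 // => l _; rewrite normr_ge0 /=.
  rewrite normrM normfV normr_nat ler_pdivrMr ?ltr0n ?fact_gt0 // mul1r.
  rewrite normrX (@le_trans _ _ 1) ?ler1n ?fact_gt0 //.
  by rewrite exprn_ile1 // (le_trans (hq l)).
Unshelve. all: by end_near. Qed.

End TaylorMulti.

Section TaylorPeano.
Context {R : realType} {m : nat}.

(** The case of [taylor_seq] with all the variables, base point [r], increment z - r and q = |z -
    r|. *)
Lemma multi_taylor_near (N : nat) (U : set 'rV[R]_m) (F : 'rV[R]_m -> R)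
    (r : 'rV[R]_m) : open U -> U r -> smooth U F ->
  exists M : R, \forall z \near r,
    `|F z - \sum_(k : {ffun 'I_m -> 'I_N.+1}) multi_partial (fun i => k i) F r *
       multi_monom (enum 'I_m) k (fun i => z 0 i - r 0 i)| <= M * `|z - r| ^+ N.+1.
Proof.
move=> oU Ur sF; have tF := taylor_seq N oU Ur sF (enum_uniq 'I_m).
near (+oo%R : set_system R) => M.
have M0 : 0 < M by near: M; apply: nbhs_pinfty_gt; exact: num_real.
have tM : forall (y : 'rV[R]_m) (h : 'I_m -> R) (q : R),
    `|y - r| <= M^-1 -> 0 <= q <= M^-1 -> (forall i, `|h i| <= q) ->
    `|F (y + \sum_(i <- enum 'I_m) h i *: delta_mx 0 i) -
      multi_taylor N F (enum 'I_m) h y| <= M * q ^+ N.+1.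
  by near: M; exact: tF.
exists M; near=> z.
have zr : `|z - r| <= M^-1.
  rewrite distrC; near: z; apply: (@cvgr_dist_le _ _ _ (nbhs r) _ id) => //.
  by rewrite invr_gt0.
have := tM r (fun i => z 0 i - r 0 i) `|z - r|.
rewrite subrr normr0 invr_ge0 (ltW M0) normr_ge0 zr => /(_ isT isT).
have -> : r + \sum_(i <- enum 'I_m) (z 0 i - r 0 i) *: delta_mx 0 i = z.
  apply/rowP => j; rewrite mxE summxE big_enum /= (bigD1 j) //= big1 => [|i ij].
    by rewrite !mxE !eqxx mulr1 addr0 addrC subrK.
  by rewrite !mxE eq_sym (negPf ij) andbF mulr0.
rewrite /multi_taylor (eq_bigl xpredT); last first.
  by move=> k; apply/forallP => i; rewrite mem_enum.
apply => i.
by have := normr_coord_le (z - r) i; rewrite !mxE.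
Unshelve. all: by end_near. Qed.

End TaylorPeano.

(** * Little-oh polynomials *)

Section LittleOhPoly.
Context {R : realType}.

Section NormedModule.
Context {V : normedModType R}.
Implicit Types (U : set V) (x y : R -> V).

Lemma lo_equivP x y : lo_equiv x y <->
  x 0 = y 0 /\ forall e : R, 0 < e -> \forall t \near (0 : R)^'+, `|x t - y t| <= e * t.
Proof.
split=> [[xy0 /eqaddoP h]|[xy0 h]]; split=> //.
- move=> e /h; apply: filterS2 (nbhs_right_gt (0 : R)) => t t0.
  by rewrite /= (gtr0_norm t0).
- apply/eqaddoP => e /h; apply: filterS2 (nbhs_right_gt (0 : R)) => t t0.
  by rewrite /= (gtr0_norm t0).
Qed.

Lemma little_oh_polyE U x : little_oh_poly U x <->
  (exists2 e : R, 0 < e & forall t, 0 <= t < e -> U (x t)) /\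
  exists k (c : 'I_k -> V) (a : 'I_k -> R), (forall i, 0 < a i) /\
    lo_equiv x (fun t => x 0 + \sum_(i < k) t `^ a i *: c i).
Proof.
split=> -[Ux [k [c [a [a0 hx]]]]]; split=> //; exists k, c, a; split=> //.
  by split=> //; rewrite big1 ?addr0 // => i _; rewrite powR0 ?scale0r ?gt_eqF.
by case: hx.
Qed.

(** Restricted to [setT] because a change by o(t) may leave a smaller set. *)
Lemma little_oh_poly_equiv x y : lo_equiv x y ->
  little_oh_poly setT y -> little_oh_poly setT x.
Proof.
move=> xy /little_oh_polyE[_ [k [c [a [a0 hy]]]]]; apply/little_oh_polyE.
split; first by exists 1.
exists k, c, a; split=> //; have [-> _] := xy.
exact: lo_equiv_trans hy.
Qed.

(** Write t^b = t * t^(b - 1), where the second factor tends to 0. *)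
Lemma lo_equiv_powR x y (A b : R) : 1 < b -> x 0 = y 0 ->
  (\forall t \near (0 : R)^'+, `|x t - y t| <= A * t `^ b) -> lo_equiv x y.
Proof.
move=> b1 xy0 hA; apply/lo_equivP; split=> // e e0.
have b10 : 0 < b - 1 by rewrite subr_gt0.
have e1 : 0 < e / (`|A| + 1) by rewrite divr_gt0 // ltr_wpDl.
have /cvgr_dist_le /(_ _ e1) hb := powR_cvg0 b10.
near=> t.
have t0 : 0 < t by near: t; exact: nbhs_right_gt.
have hA' : `|x t - y t| <= A * t `^ b by near: t.
have hb' : `|0 - t `^ (b - 1)| <= e / (`|A| + 1) by near: t.
rewrite (le_trans hA') // -(@mulr_powRB1 _ t b (ltW t0) (lt_trans ltr01 b1)).
rewrite mulrCA [leRHS]mulrC ler_pM2l //.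
rewrite sub0r normrN ger0_norm ?powR_ge0 // ler_pdivlMr ?ltr_wpDl // in hb'.
rewrite (le_trans _ hb') // mulrC ler_wpM2l ?powR_ge0 //.
by rewrite (le_trans (ler_norm _)) // lerDl.
Unshelve. all: by end_near. Qed.

Lemma near_right_le1 : \forall t \near (0 : R)^'+, 0 < t <= 1.
Proof.
near=> t; apply/andP; split; near: t; first exact: nbhs_right_gt.
exact: nbhs_right_le.
Unshelve. all: by end_near. Qed.

Lemma lo_equiv_near1 x y : lo_equiv x y -> \forall t \near (0 : R)^'+, `|x t - y t| <= t.
Proof. by move=> /lo_equivP[_ /(_ 1 ltr01)]; apply: filterS => t; rewrite mul1r. Qed.

(** The exponent is the minimum of 1 and of the exponents of [x]: for t <= 1 its power dominates all
    the others, and the 1 takes care of the o(t) remainder. *)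
Lemma little_oh_poly_holder U x : little_oh_poly U x ->
  exists a A : R, 0 < a /\ \forall t \near (0 : R)^'+, `|x t - x 0| <= A * t `^ a.
Proof.
move=> /little_oh_polyE[_ [k [c [a [a0 /lo_equiv_near1 hx]]]]].
exists (\big[Num.min/1]_(i < k) a i), (1 + \sum_(i < k) `|c i|).
split; first by apply/bigmin_gtP; split.
near=> t.
have t01 : 0 < t <= 1 by near: t; exact: near_right_le1.
have /andP[t0 t1] := t01.
set S := fun t : R => \sum_(i < k) t `^ a i *: c i.
have -> : x t - x 0 = (x t - (x 0 + S t)) + S t by rewrite opprD addrA subrK.
rewrite (le_trans (ler_normD _ _)) // mulrDl mul1r lerD //.
  apply: (@le_trans _ _ t); first by near: t.
  rewrite -[leLHS](powRr1 (ltW t0)); apply: ger_powR => //; exact: bigmin_le_id.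
rewrite (le_trans (ler_norm_sum _ _ _)) // mulr_suml; apply: ler_sum => i _.
rewrite normrZ mulrC ler_wpM2l // ger0_norm ?powR_ge0 //.
by apply: ger_powR => //; exact: bigmin_le_cond.
Unshelve. all: by end_near. Qed.

Lemma little_oh_poly_bounded U x : little_oh_poly U x ->
  exists B : R, \forall t \near (0 : R)^'+, `|x t| <= B.
Proof.
move=> /little_oh_poly_holder[a [A [a0 hA]]]; exists (`|A| + `|x 0|).
near=> t; rewrite -[x t](subrK (x 0)) (le_trans (ler_normD _ _)) // lerD2r.
have t01 : 0 < t <= 1 by near: t; exact: near_right_le1.
have hA' : `|x t - x 0| <= A * t `^ a by near: t.
rewrite (le_trans hA') // (@le_trans _ _ (`|A| * t `^ a)) //.
  by rewrite ler_wpM2r ?powR_ge0 // ler_norm.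
by rewrite -[leRHS]mulr1 ler_wpM2l // -(powRr0 t); apply: ger_powR => //; exact: ltW.
Unshelve. all: by end_near. Qed.

End NormedModule.

Implicit Types (x y : R -> R).

(** In x y - x' y' = (x - x') y + x' (y - y') only [y] and [x'] have to be bounded near 0. *)
Lemma lo_equivM x x' y y' : little_oh_poly setT x' -> little_oh_poly setT y ->
  lo_equiv x x' -> lo_equiv y y' -> lo_equiv (x * y) (x' * y').
Proof.
move=> /little_oh_poly_bounded[B hB] /little_oh_poly_bounded[C hC].
move=> /lo_equivP[x0 hx] /lo_equivP[y0 hy]; apply/lo_equivP; split.
  by rewrite -[LHS]/(x 0 * y 0) x0 y0.
move=> e e0.
have B1 : 0 < `|B| + 1 by rewrite ltr_wpDl.
have C1 : 0 < `|C| + 1 by rewrite ltr_wpDl.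
near=> t.
have t0 : 0 < t by near: t; exact: nbhs_right_gt.
rewrite -[_ - _]/(x t * y t - x' t * y' t).
have -> : x t * y t - x' t * y' t = (x t - x' t) * y t + x' t * (y t - y' t) by ring.
have hx' : `|x t - x' t| <= e / 2 / (`|C| + 1) * t.
  by near: t; apply: hx; rewrite !divr_gt0.
have hy' : `|y t - y' t| <= e / 2 / (`|B| + 1) * t.
  by near: t; apply: hy; rewrite !divr_gt0.
have hB' : `|x' t| <= `|B| + 1.
  by apply: (@le_trans _ _ B); [near: t|rewrite (le_trans (ler_norm _)) // lerDl].
have hC' : `|y t| <= `|C| + 1.
  by apply: (@le_trans _ _ C); [near: t|rewrite (le_trans (ler_norm _)) // lerDl].
rewrite (le_trans (ler_normD _ _)) // !normrM.
have -> : e * t = (e / 2 / (`|C| + 1) * t) * (`|C| + 1) +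
                  (`|B| + 1) * (e / 2 / (`|B| + 1) * t).
  by field; rewrite !gt_eqF.
by rewrite lerD // ler_pM.
Unshelve. all: by end_near. Qed.

(** The delicate point is t = 0: if b + c = 0 then both exponents vanish and both sides are 1. *)
Lemma powRD_ge0 (t b c : R) : 0 <= b -> 0 <= c -> t `^ (b + c) = t `^ b * t `^ c.
Proof.
move=> b0 c0; have [bc0|bc0] := eqVneq (b + c) 0; last by rewrite powRD // (negPf bc0).
move: (bc0) => /eqP; rewrite paddr_eq0 // => /andP[/eqP b0' /eqP c0'].
by rewrite bc0 b0' c0' powRr0 mulr1.
Qed.

(** Entries of [s] are pairs (exponent, coefficient). The exponent 0 is allowed, so that the
    constant term is a summand like the others and products expand uniformly. *)
Definition powR_sum (s : seq (R * R)) (t : R) : R := \sum_(p <- s) t `^ p.1 * p.2.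

Lemma little_oh_poly_powR (b c : R) : 0 <= b ->
  little_oh_poly setT (fun t : R => t `^ b * c).
Proof.
rewrite le_eqVlt => /predU1P[<-|b0].
  under eq_fun do rewrite powRr0 mul1r; exact: little_oh_poly_cst.
apply/little_oh_polyE; split; first by exists 1.
exists 1%N, (fun=> c), (fun=> b); split=> //.
rewrite /= powR0 ?gt_eqF // mul0r.
under [X in lo_equiv _ X]eq_fun do rewrite big_ord1 add0r.
exact: lo_equiv_refl.
Qed.

Lemma little_oh_poly_powR_sum (s : seq (R * R)) : (forall p, p \in s -> 0 <= p.1) ->
  little_oh_poly setT (powR_sum s).
Proof.
elim: s => [_|p s IH hs].
  rewrite (_ : powR_sum _ = cst 0); first exact: little_oh_poly_cst.
  by apply/funext => t; rewrite /powR_sum big_nil.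
rewrite (_ : powR_sum _ = (fun t => t `^ p.1 * p.2) + powR_sum s).
  apply: little_oh_polyD; first by apply: little_oh_poly_powR; apply: hs; exact: mem_head.
  by apply: IH => q qs; apply: hs; rewrite inE qs orbT.
by apply/funext => t; rewrite /powR_sum big_cons.
Qed.

Lemma little_oh_poly_powR_sumP x : little_oh_poly setT x <->
  exists2 s : seq (R * R), (forall p, p \in s -> 0 <= p.1) & lo_equiv x (powR_sum s).
Proof.
split=> [/little_oh_polyE[_ [k [c [a [a0 hx]]]]]|[s s0 /little_oh_poly_equiv]]; last first.
  by apply; exact: little_oh_poly_powR_sum.
exists ((0, x 0) :: [seq (a i, c i) | i <- enum 'I_k]).
  by move=> p; rewrite inE => /predU1P[->//|/mapP[i _ ->]]; exact/ltW/a0.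
rewrite (_ : powR_sum _ = fun t => x 0 + \sum_(i < k) t `^ a i *: c i) //.
by apply/funext => t; rewrite /powR_sum big_cons /= powRr0 mul1r big_map big_enum.
Qed.

(** Both factors are replaced by equivalent sums of powers, whose product is again such a sum. *)
Lemma little_oh_polyM x y : little_oh_poly setT x -> little_oh_poly setT y ->
  little_oh_poly setT (x * y).
Proof.
move=> /[dup] lx /little_oh_poly_powR_sumP[s s0 hx] /[dup] ly /little_oh_poly_powR_sumP[u u0 hy].
apply: (little_oh_poly_equiv (lo_equivM (little_oh_poly_powR_sum s0) ly hx hy)).
pose w := [seq (p.1 + q.1, p.2 * q.2) | p <- s, q <- u].
have w0 p : p \in w -> 0 <= p.1.
  by move=> /allpairsP[[p1 p2] /= [/s0 ? /u0 ? ->]]; rewrite addr_ge0.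
rewrite (_ : _ * _ = powR_sum w); first exact: little_oh_poly_powR_sum.
apply/funext => t; rewrite -[LHS]/(powR_sum s t * powR_sum u t) /powR_sum big_distrlr /=.
rewrite /w big_allpairs_dep; apply: eq_big_seq => p ps; apply: eq_big_seq => q qu /=.
by rewrite (powRD_ge0 t (s0 _ ps) (u0 _ qu)) mulrACA.
Qed.

Lemma little_oh_polyX x (n : nat) : little_oh_poly setT x ->
  little_oh_poly setT (fun t => x t ^+ n).
Proof.
move=> hx; elim: n => [|n IH].
  by under eq_fun do rewrite expr0; exact: little_oh_poly_cst.
by under eq_fun do rewrite exprS; exact: little_oh_polyM.
Qed.

Lemma lo_equivX x y (n : nat) : little_oh_poly setT x -> little_oh_poly setT y ->
  lo_equiv x y -> lo_equiv (fun t => x t ^+ n) (fun t => y t ^+ n).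
Proof.
move=> hx hy xy; elim: n => [|n IH]; first exact: lo_equiv_refl.
have XS (z : R -> R) : (fun t => z t ^+ n.+1) = z * (fun t => z t ^+ n).
  by apply/funext => t; rewrite exprS.
rewrite !XS; exact: lo_equivM hy (little_oh_polyX n hx) xy IH.
Qed.

Lemma little_oh_poly_prod (I : Type) (s : seq I) (x : I -> R -> R) :
  (forall i, little_oh_poly setT (x i)) ->
  little_oh_poly setT (fun t => \prod_(i <- s) x i t).
Proof.
move=> hx; rewrite (_ : (fun t => _) = \prod_(i <- s) x i); last first.
  apply/funext => t; elim: s => [|i s IH]; first by rewrite !big_nil.
  by rewrite !big_cons IH.
elim/big_rec: _ => [|i y _ hy]; [exact: little_oh_poly_cst|exact: little_oh_polyM].
Qed.

Lemma lo_equiv_prod (I : Type) (s : seq I) (x y : I -> R -> R) :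
  (forall i, little_oh_poly setT (x i)) -> (forall i, little_oh_poly setT (y i)) ->
  (forall i, lo_equiv (x i) (y i)) ->
  lo_equiv (fun t => \prod_(i <- s) x i t) (fun t => \prod_(i <- s) y i t).
Proof.
move=> hx hy xy; elim: s => [|i s IH].
  by under eq_fun do rewrite big_nil; under [X in lo_equiv _ X]eq_fun do rewrite big_nil;
    exact: lo_equiv_refl.
under eq_fun do rewrite big_cons.
under [X in lo_equiv _ X]eq_fun do rewrite big_cons.
exact: (lo_equivM (hy i) (little_oh_poly_prod s hx) (xy i) IH).
Qed.

End LittleOhPoly.

(** * Coefficients of Fermat reals *)

Section Coefficients.
Context {R : realType}.
Implicit Types (x y : R -> R) (X Y : fermat_real R) (p q : R * (R -> R)).

Lemma fclassD x y : little_oh_poly setT x -> little_oh_poly setT y ->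
  fclass (x + y) = fclass x + fclass y.
Proof.
move=> hx hy; apply: fermat_real_eq.
apply: lo_equiv_trans (fclassK (little_oh_polyD hx hy)) _.
apply/lo_equiv_sym; apply: lo_equiv_trans (frepD _ _) _.
exact: lo_equivD (fclassK hx) (fclassK hy).
Qed.

Lemma fclassZ (l : R) x : little_oh_poly setT x ->
  fclass (fun t => l * x t) = l *: fclass x.
Proof.
move=> hx; apply: fermat_real_eq.
apply: lo_equiv_trans (fclassK (@little_oh_polyZ R R^o l x hx)) _.
apply/lo_equiv_sym; apply: lo_equiv_trans (frepZ _ _) _.
exact: lo_equivZ (fclassK hx).
Qed.

(** The two claims go together because additivity of [fclass] at each step of the induction requires
    the partial sum to be a little-oh polynomial. *)
Lemma fclass_sum (I : Type) (s : seq I) (c : I -> R) (x : I -> R -> R) :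
  (forall i, little_oh_poly setT (x i)) ->
  little_oh_poly setT (fun t => \sum_(i <- s) c i * x i t) /\
  fclass (fun t => \sum_(i <- s) c i * x i t) = \sum_(i <- s) c i *: fclass (x i).
Proof.
move=> hx; elim: s => [|i s [IH1 IH2]].
  under eq_fun do rewrite big_nil; rewrite big_nil.
  by split=> //; exact: little_oh_poly_cst.
have -> : (fun t => \sum_(j <- i :: s) c j * x j t) =
    (fun t => c i * x i t) + (fun t => \sum_(j <- s) c j * x j t).
  by apply/funext => t; rewrite big_cons.
have h := @little_oh_polyZ R R^o (c i) (x i) (hx i).
by split; [exact: little_oh_polyD|rewrite fclassD // IH2 fclassZ // big_cons].
Qed.

(* The standard part is the coefficient of t^0. *)
Definition qcoef (e : R) p : R := if e == 0 then p.1 else p.2 e.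

Lemma qcoefD e p q : qcoef e (p + q) = qcoef e p + qcoef e q.
Proof. by rewrite /qcoef; case: eqP. Qed.

Definition fcoef (e : R) X : R := qcoef e (qdec X).

Lemma fcoefD e X Y : fcoef e (X + Y) = fcoef e X + fcoef e Y.
Proof. by rewrite /fcoef qdecD qcoefD. Qed.

Lemma fcoefZ e l X : fcoef e (l *: X) = l * fcoef e X.
Proof. by rewrite /fcoef qdecZ /qcoef; case: eqP. Qed.

Lemma fcoefB e X Y : fcoef e (X - Y) = fcoef e X - fcoef e Y.
Proof. by rewrite fcoefD -(scaleN1r Y) fcoefZ mulN1r. Qed.

Lemma fcoef_sum e (I : Type) (s : seq I) (X : I -> fermat_real R) :
  fcoef e (\sum_(i <- s) X i) = \sum_(i <- s) fcoef e (X i).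
Proof.
elim: s => [|i s IH]; last by rewrite !big_cons fcoefD IH.
by rewrite !big_nil -(scale0r 0) fcoefZ mul0r.
Qed.

(** The square of a coefficient is one of the nonnegative terms of the inner product of [X] with
    itself. *)
Lemma normr_fcoef_le e X : 0 <= e <= 1 -> `|fcoef e X| <= fermat_norm X.
Proof.
move=> /andP[e0 e1]; rewrite -sqrtr_sqr ler_wsqrtr // /fcoef /qcoef /fermat_inner.
have sq0 i : 0 <= (qdec X).2 i * (qdec X).2 i by rewrite -expr2 sqr_ge0.
case: eqP => [_|/eqP ne0]; first by rewrite expr2 lerDl; apply: fsumr_ge0.
have [fX sX _] := qdecP X.
have [->|Xe] := eqVneq ((qdec X).2 e) 0.
  by rewrite expr0n addr_ge0 // -?expr2 ?sqr_ge0 //; apply: fsumr_ge0.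
(* Restricting the sum to the finite support allows the term of index [e] to be split off. *)
rewrite -(fsbig_widen [set i | (qdec X).2 i != 0]); first last.
- by move=> i [_ /= /negP]; rewrite negbK => /eqP ->; rewrite mulr0.
- by move=> i /sX.
rewrite (fsbigD1 e) //= -expr2 addrCA lerDl addr_ge0 // -?expr2 ?sqr_ge0 //.
exact: fsumr_ge0.
Qed.

(** Three cases: for b = 0 the path is constant, for 0 < b <= 1 it is its own decomposition, and for
    b > 1 it is o(t), so that all its coefficients vanish, in accordance with e <= 1 < b. *)
Lemma quasi_decomp_powR_coef (b c : R) : 0 <= b ->
  exists2 p, quasi_decomp (fun t => t `^ b * c) p &
    forall e, 0 <= e <= 1 -> qcoef e p = (b == e)%:R * c.
Proof.
rewrite le_eqVlt => /predU1P[<-|b0].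
  exists (c, cst 0).
    by under eq_fun do rewrite powRr0 mul1r; exact: quasi_decomp_cst.
  by move=> e _; rewrite /qcoef eq_sym; case: eqP; rewrite ?mul1r ?mul0r.
have [b1|b1] := leP b 1.
  exists (0, fun i => (b == i)%:R * c).
    split=> /=.
    - apply: (@sub_finite_set _ _ [set b]) (finite_set1 b) => i /=.
      by have [->//|_] := eqVneq b i; rewrite mul0r eqxx.
    - by move=> i; have [<- _|_] := eqVneq b i; [rewrite b0|rewrite mul0r eqxx].
    rewrite (_ : quasi_sum _ = fun t => t `^ b * c); first exact: lo_equiv_refl.
    apply/funext => t; rewrite /quasi_sum /= add0r -(fsbig_widen [set b]).
    - by rewrite fsbig_set1 eqxx mul1r mulrC.
    - by move=> i /= ->; rewrite in_itv /= b0 b1.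
    - by move=> i [_ /= ib]; have [/esym//|_] := eqVneq b i; rewrite !mul0r.
  move=> e _; rewrite /qcoef /=; case: (eqVneq e 0) => // ->.
  by rewrite gt_eqF // mul0r.
exists (0, cst 0); last first.
  move=> e /andP[_ e1]; rewrite (gt_eqF (le_lt_trans e1 b1)) mul0r.
  by rewrite /qcoef; case: ifP.
apply: quasi_decomp_equiv (quasi_decomp_cst 0).
apply: (@lo_equiv_powR _ _ _ _ `|c| b) => //=; first by rewrite powR0 ?mul0r ?gt_eqF.
by near=> t; rewrite /= subr0 normrM mulrC [`|t `^ b|]ger0_norm ?powR_ge0.
Unshelve. all: by end_near. Qed.

Lemma fcoef_fclass_powR (b c e : R) x : 0 <= b -> 0 <= e <= 1 ->
  little_oh_poly setT x -> lo_equiv x (fun t => t `^ b * c) ->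
  fcoef e (fclass x) = (b == e)%:R * c.
Proof.
move=> b0 e01 lx hx; have [p hp pE] := quasi_decomp_powR_coef c b0.
rewrite /fcoef (@qdec_eq _ _ p) ?pE //.
exact/(quasi_decomp_equiv (fclassK lx))/(quasi_decomp_equiv hx).
Qed.

End Coefficients.

(** * Fermat extensions as combinations of classes of monomial paths *)

Section FermatExtension.
Context {R : realType} {m : nat}.
Implicit Types (U : set 'rV[R]_m) (F : 'rV[R]_m -> R) (x y : R -> 'rV[R]_m).

Lemma lo_equiv_coord x y i : lo_equiv x y ->
  lo_equiv (fun t => x t 0 i) (fun t => y t 0 i).
Proof.
move=> /lo_equivP[xy0 hxy]; apply/lo_equivP; split; first by rewrite xy0.
move=> e /hxy; apply: filterS => t; apply: le_trans.
by have -> : x t 0 i - y t 0 i = (x t - y t) 0 i; [rewrite !mxE|exact: normr_coord_le].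
Qed.

Lemma little_oh_poly_coord U x i : little_oh_poly U x ->
  little_oh_poly setT (fun t => x t 0 i).
Proof.
move=> /little_oh_polyE[_ [k [c [a [a0 hx]]]]]; apply/little_oh_polyE.
split; first by exists 1.
exists k, (fun j => c j 0 i), a; split=> //.
rewrite (_ : (fun t => _ + _) = fun t => (x 0 + \sum_(j < k) t `^ a j *: c j) 0 i).
  exact: (lo_equiv_coord i hx).
apply/funext => t; rewrite mxE summxE; congr (_ + _).
by apply: eq_bigr => j _; rewrite mxE.
Qed.

Definition monom_path N (k : {ffun 'I_m -> 'I_N.+1}) x (t : R) : R :=
  multi_monom (enum 'I_m) k (fun i => x t 0 i - x 0 0 i).

Lemma little_oh_poly_increment U x (i : 'I_m) : little_oh_poly U x ->
  little_oh_poly setT (fun t => x t 0 i - x 0 0 i).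
Proof.
move=> hx; exact: little_oh_polyD (little_oh_poly_coord i hx)
  (little_oh_poly_cst (- x 0 0 i)).
Qed.

Lemma little_oh_poly_factor U x (i : 'I_m) (n : nat) : little_oh_poly U x ->
  little_oh_poly setT (fun t => (x t 0 i - x 0 0 i) ^+ n / n`!%:R).
Proof.
move=> /(little_oh_poly_increment i)/(little_oh_polyX n) hx.
by apply: (@little_oh_polyM _ _ (cst n`!%:R^-1)) hx _; exact: little_oh_poly_cst.
Qed.

Lemma little_oh_poly_monom U x N (k : {ffun 'I_m -> 'I_N.+1}) :
  little_oh_poly U x -> little_oh_poly setT (monom_path k x).
Proof.
by move=> hx; apply: little_oh_poly_prod => i; exact: (@little_oh_poly_factor U).
Qed.

(** Along the path the Taylor remainder is at most a constant times t^(a (N + 1)), which is o(t)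
    because the exponent exceeds 1. On the right only the scalars depend on [F]. *)
Lemma fermat_ext_expansion (N : nat) U F (X : fermat U) (a A : R) :
  open U -> smooth U F -> 1 < a * N.+1%:R ->
  (\forall t \near (0 : R)^'+, `|frep X t - frep X 0| <= A * t `^ a) ->
  fermat_ext U F X = \sum_(k : {ffun 'I_m -> 'I_N.+1})
    multi_partial (fun i => k i) F (frep X 0) *: fclass (monom_path k (frep X)).
Proof.
move=> oU sF aN hA; have lX := frepP X; set x := frep X.
have U0 : U (x 0) by have [[e e0 +] _] := lX; apply; rewrite lexx.
have [lT <-] := @fclass_sum _ _ (index_enum {ffun 'I_m -> 'I_N.+1})
  (fun k : {ffun 'I_m -> 'I_N.+1} => multi_partial (fun i => k i) F (x 0)) (fun k => monom_path k x)
  (fun k => little_oh_poly_monom k lX).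
have [M hM] := multi_taylor_near N oU U0 sF.
have A0 : 0 <= A.
  near (0 : R)^'+ => t.
  have t0 : 0 < t by near: t; exact: nbhs_right_gt.
  rewrite -(pmulr_lge0 _ (powR_gt0 a t0)) (@le_trans _ _ `|x t - x 0|) //.
  by near: t.
suff E : lo_equiv (F \o x) (fun t => \sum_(k : {ffun 'I_m -> 'I_N.+1})
    multi_partial (fun i => k i) F (x 0) * monom_path k x t).
  by apply/fclass_eq => //; exact: little_oh_poly_equiv E lT.
apply: (@lo_equiv_powR _ _ _ _ (`|M| * A ^+ N.+1) (a * N.+1%:R)) => //.
  (* At z = r the Taylor bound reads 0 on the right, so both paths agree at t = 0. *)
  have := nbhs_singleton hM; rewrite subrr normr0 expr0n mulr0 normr_le0 subr_eq0.
  by move/eqP.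
(* The power bound makes the path right-continuous at 0, so that the bound [hM], valid near x(0),
   holds along it. *)
have xc : x t @[t --> 0^'+] --> x 0.
  apply/cvgrPdist_le => e e0.
  have a0 : 0 < a by rewrite -(pmulr_lgt0 _ (ltr0Sn R N)) (lt_trans ltr01).
  have e1 : 0 < e / (A + 1) by rewrite divr_gt0 // ltr_wpDl.
  have /cvgr_dist_le /(_ _ e1) hb := powR_cvg0 a0.
  near=> t; rewrite distrC.
  have hA' : `|x t - x 0| <= A * t `^ a by near: t.
  have : `|0 - t `^ a| <= e / (A + 1) by near: t.
  rewrite sub0r normrN ger0_norm ?powR_ge0 // ler_pdivlMr ?ltr_wpDl // => hb'.
  rewrite (le_trans hA') // (le_trans _ hb') // mulrC ler_wpM2l ?powR_ge0 //.
  by rewrite lerDl.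
have hMx := xc _ hM.
near=> t.
have t0 : 0 < t by near: t; exact: nbhs_right_gt.
have hMt : `|F (x t) - \sum_(k : {ffun 'I_m -> 'I_N.+1})
    multi_partial (fun i => k i) F (x 0) * monom_path k x t| <= M * `|x t - x 0| ^+ N.+1.
  by near: t; exact: hMx.
have hA' : `|x t - x 0| <= A * t `^ a by near: t.
rewrite (le_trans hMt) // powRrM powR_mulrn ?powR_ge0 // -mulrA -exprMn.
rewrite (@le_trans _ _ (`|M| * `|x t - x 0| ^+ N.+1)) //.
  by rewrite ler_wpM2r ?exprn_ge0 // ler_norm.
by rewrite ler_wpM2l // lerXn2r // ?nnegrE ?mulr_ge0 ?powR_ge0.
Unshelve. all: by end_near. Qed.

End FermatExtension.

(** * Exponents separating multi-indices *)

Section Digits.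

Lemma digits_lt D m (k : 'I_m -> nat) : (forall i, k i < D)%N ->
  (\sum_i k i * D ^ i < D ^ m)%N.
Proof.
elim: m k => [|m IH] k kD; first by rewrite big_ord0.
rewrite big_ord_recl expn0 muln1.
under eq_bigr do rewrite /= /bump /= add1n expnS mulnCA.
rewrite -big_distrr /= expnS.
apply: (@leq_trans (D + D * \sum_(i < m) k (lift ord0 i) * D ^ i)%N).
  by rewrite -addSn leq_add2r kD.
by rewrite -mulnS leq_mul2l IH ?orbT.
Qed.

(** Uniqueness of expansions in base [D]: the remainder modulo [D] is the lowest digit, the quotient
    encodes the others. *)
Lemma digits_inj D m (k l : 'I_m -> nat) :
  (forall i, k i < D)%N -> (forall i, l i < D)%N ->
  (\sum_i k i * D ^ i = \sum_i l i * D ^ i)%N -> k =1 l.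
Proof.
elim: m k l => [|m IH] k l kD lD; first by move=> _ [].
have E (h : 'I_m.+1 -> nat) : (forall i, h i < D)%N ->
    (\sum_i h i * D ^ i = (\sum_(i < m) h (lift ord0 i) * D ^ i) * D + h ord0)%N.
  move=> hD; rewrite big_ord_recl expn0 muln1 addnC big_distrl /=; congr (_ + _)%N.
  by apply: eq_bigr => i _; rewrite /= /bump /= add1n expnSr mulnA.
rewrite !E // => eq_kl i.
have D0 : (0 < D)%N by apply: leq_ltn_trans (kD ord0).
case: (unliftP ord0 i) => [j|] ->.
  apply: (IH (fun j => k (lift ord0 j)) (fun j => l (lift ord0 j))) => //.
  by have := congr1 (divn^~ D) eq_kl; rewrite !divnMDl // !divn_small // !addn0.
by have := congr1 (modn^~ D) eq_kl; rewrite !modnMDl !modn_small.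
Qed.

(* The first summand orders the multi-indices by total degree, the second one
   separates those of equal degree. *)
Definition weight D m (k : 'I_m -> nat) : nat := (\sum_i k i * (D ^ m + D ^ i))%N.

Lemma weightE D m (k : 'I_m -> nat) :
  weight D k = ((\sum_i k i) * D ^ m + \sum_i k i * D ^ i)%N.
Proof.
by rewrite /weight; under eq_bigr do rewrite mulnDr; rewrite big_split /= big_distrl.
Qed.

(** Modulo D^m only the base [D] expansion remains. *)
Lemma weight_inj D m (k l : 'I_m -> nat) :
  (forall i, k i < D)%N -> (forall i, l i < D)%N ->
  weight D k = weight D l -> k =1 l.
Proof.
move=> kD lD; rewrite !weightE => /(congr1 (modn^~ (D ^ m)%N)).
rewrite !modnMDl !modn_small ?digits_lt //; exact: digits_inj.
Qed.

(** A total degree below [D] makes every digit smaller than [D], so the second summand of the weight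
    fits into one more copy of D^m. *)
Lemma weight_le D m (k : 'I_m -> nat) : (\sum_i k i < D)%N ->
  (weight D k <= D ^ m.+1)%N.
Proof.
move=> kD; rewrite weightE expnS.
apply: (@leq_trans (((\sum_i k i).+1) * D ^ m)%N); last by rewrite leq_mul2r kD orbT.
rewrite mulSn addnC leq_add2r ltnW // digits_lt // => i.
by apply: leq_ltn_trans kD; rewrite (bigD1 i) //= leq_addr.
Qed.

End Digits.

(** * Paths whose coordinates are powers of t *)

Section PowerPath.
Context {R : realType} {m : nat}.
Implicit Types (U : set 'rV[R]_m) (r : 'rV[R]_m) (a : 'I_m -> R).

Definition power_path r a (t : R) : 'rV[R]_m :=
  r + \sum_i t `^ a i *: delta_mx 0 i.

Lemma power_pathE r a t i : power_path r a t 0 i = r 0 i + t `^ a i.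
Proof.
rewrite mxE summxE (bigD1 i) //= big1 => [|j ji].
  by rewrite !mxE !eqxx mulr1 addr0.
by rewrite !mxE [i == j]eq_sym (negPf ji) andbF mulr0.
Qed.

Lemma power_path0 r a : (forall i, 0 < a i) -> power_path r a 0 = r.
Proof. by move=> a0; apply/rowP => i; rewrite power_pathE powR0 ?addr0 ?gt_eqF. Qed.

Lemma power_path_holder r a (b t : R) : (forall i, b <= a i) -> 0 < t <= 1 ->
  `|power_path r a t - r| <= t `^ b.
Proof.
move=> ba t01; rewrite [leLHS]mx_normrE.
apply/bigmax_leP; split=> [|[i j] _] /=; first exact: powR_ge0.
have -> : (power_path r a t - r) i j = t `^ a j.
  by rewrite ord1 mxE [X in _ + X]mxE power_pathE addrAC subrr add0r.
by rewrite ger0_norm ?powR_ge0 //; exact: ger_powR.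
Qed.

Lemma little_oh_power_path U r a (b : R) : open U -> U r -> 0 < b ->
  (forall i, b <= a i) -> little_oh_poly U (power_path r a).
Proof.
move=> oU Ur b0 ba.
have a0 i : 0 < a i by exact: lt_le_trans (ba i).
apply/little_oh_polyE; split; last first.
  exists m, (fun i => delta_mx 0 i), a; split=> //; rewrite power_path0 //.
  exact: lo_equiv_refl.
have /nbhs_normP[d /= d0 hd] : nbhs r U by exact: open_nbhs_nbhs.
have /cvgr_dist_lt/(_ _ d0) hb := powR_cvg0 b0.
have : \forall t \near (0 : R)^'+, U (power_path r a t).
  near=> t; apply: hd; rewrite /= distrC.
  have t01 : 0 < t <= 1 by near: t; exact: near_right_le1.
  apply: (le_lt_trans (power_path_holder r ba t01)).
  by rewrite -[ltLHS]ger0_norm ?powR_ge0 // -normrN -sub0r; near: t.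
move=> /nbhs_ballP[e /= e0 he]; exists e => // t /andP[t0 te].
have [->|tn0] := eqVneq t 0; first by rewrite power_path0.
have tp : 0 < t by rewrite lt_def tn0.
by apply: he => //; rewrite /ball /= sub0r normrN gtr0_norm.
Unshelve. all: by end_near. Qed.

Lemma multi_monom_powR N (k : {ffun 'I_m -> 'I_N.+1}) a t : (forall i, 0 <= a i) ->
  multi_monom (enum 'I_m) k (fun i => t `^ a i) =
  t `^ (\sum_i a i * (k i)%:R) * \prod_i (k i)`!%:R^-1.
Proof.
move=> a0; rewrite /multi_monom big_split /= !big_enum /=; congr (_ * _).
(* Nonnegativity of the accumulated exponent is carried along because [powRD_ge0] asks for it at
   each step. *)
have [] // : 0 <= \sum_i a i * (k i)%:R /\
  \prod_i (t `^ a i) ^+ k i = t `^ (\sum_i a i * (k i)%:R).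
elim/big_ind2: _ => [|x1 x2 y1 y2 [x0 ->] [y0 ->]|i _].
- by rewrite powRr0.
- by rewrite addr_ge0 // powRD_ge0.
- by rewrite mulr_ge0 // powRrM powR_mulrn ?powR_ge0.
Qed.

(** This lets monomial paths of an arbitrary representative be computed on an explicit one. *)
Lemma lo_equiv_monom_path U N (k : {ffun 'I_m -> 'I_N.+1}) (x y : R -> 'rV[R]_m) :
  little_oh_poly U x -> little_oh_poly U y -> lo_equiv x y ->
  lo_equiv (monom_path k x) (monom_path k y).
Proof.
move=> hx hy xy; apply: lo_equiv_prod => i; try exact: (@little_oh_poly_factor _ _ U).
have E : lo_equiv (fun t => x t 0 i - x 0 0 i) (fun t => y t 0 i - y 0 0 i).
  have [-> _] := xy.
  exact: lo_equivD (lo_equiv_coord i xy) (lo_equiv_refl (cst (- y 0 0 i))).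
apply: (lo_equivM _ _ _ (lo_equiv_refl (cst _))).
- exact/little_oh_polyX/(little_oh_poly_increment _ hy).
- exact: little_oh_poly_cst.
- by apply: lo_equivX E; apply: (@little_oh_poly_increment _ _ U).
Qed.

End PowerPath.

(** * Convergence *)

Section Convergence.
Context {R : realType} {m : nat}.
Implicit Types (U : set 'rV[R]_m) (f : nat -> 'rV[R]_m -> R).

Lemma taylor_cvg_fermat_cvg U f : open U -> (forall n, smooth U (f n)) ->
  pointwise_taylor_cvg U f ->
  pointwise_cvg (euclidean_fermat_real R) [set: fermat U] (fun n => fermat_ext U (f n)).
Proof.
move=> oU sf tf X _.
have [a [A [a0 hA]]] := little_oh_poly_holder (frepP X).
(* The order N is the integer part of 1/a, hence N + 1 > 1/a. *)
have aN : 1 < a * (Num.truncn a^-1).+1%:R.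
  by rewrite -ltr_pdivrMl // mulr1; exact: truncnS_gt.
have U0 : U (frep X 0) by have [[e e0 +] _] := frepP X; apply; rewrite lexx.
(* The monomial classes do not depend on [n]; only their finitely many scalar coefficients vary, and
   these converge. *)
under eq_fun do rewrite (fermat_ext_expansion oU (sf _) aN hA).
pose T := euclidean_fermat_real R.
pose c (k : {ffun 'I_m -> 'I_(Num.truncn a^-1).+1}) n :=
  multi_partial (fun i => k i) (f n) (frep X 0).
pose M (k : {ffun 'I_m -> 'I_(Num.truncn a^-1).+1}) : T := fclass (monom_path k (frep X)).
apply/(@cvg_ex T); exists (\sum_k lim (c k n @[n --> \oo]) *: M k).
apply: (@cvg_big T _ _ _ _ (@add_continuous T)) => k _.
apply: (@cvgZr_tmp _ T); exact: tf.
Qed.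

(** By [normr_fcoef_le], a coefficient is a 1-Lipschitz function. *)
Lemma cvg_fcoef (Y : nat -> euclidean_fermat_real R) (e : R) : 0 <= e <= 1 ->
  cvg (Y n @[n --> \oo]) -> cvg (fcoef e (Y n) @[n --> \oo]).
Proof.
move=> e01 /cvg_ex[L YL]; apply/cvg_ex; exists (fcoef e L).
apply/cvgrPdist_le => eps eps0.
have /cvgr_dist_le/(_ _ eps0) := YL; apply: filterS => n; apply: le_trans.
rewrite -fcoefB; exact: normr_fcoef_le.
Qed.

Lemma fermat_cvg_taylor_cvg U f : open U -> (forall n, smooth U (f n)) ->
  pointwise_cvg (euclidean_fermat_real R) [set: fermat U] (fun n => fermat_ext U (f n)) ->
  pointwise_taylor_cvg U f.
Proof.
move=> oU sf cf K r Ur.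
(* W * \sum_i k_i a_i is weight D k, and (N + 1) * b > 1 as b > D ^ m / W = 1 / D.
   The successor in N makes D at least 2, hence b at most 1. *)
pose N := (\sum_i K i).+1; pose D := N.+1; pose W := (D ^ m.+1)%N.
pose a (i : 'I_m) : R := (D ^ m + D ^ i)%:R / W%:R.
pose b : R := (D ^ m + 1)%:R / W%:R.
have D0 : (0 < D)%N by [].
have W0 : 0 < W%:R :> R by rewrite ltr0n expn_gt0.
have b0 : 0 < b by rewrite divr_gt0 // ltr0n addn1.
have ba i : b <= a i by rewrite ler_pM2r ?invr_gt0 // ler_nat leq_add2l expn_gt0.
have a0 i : 0 < a i by exact: lt_le_trans (ba i).
have b1 : b <= 1.
  rewrite ler_pdivrMr // mul1r ler_nat /W expnS (@leq_trans (2 * D ^ m)) //.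
    by rewrite mul2n -addnn leq_add2l expn_gt0.
  by rewrite leq_mul2r orbC.
have bN : 1 < b * N.+1%:R.
  rewrite mulrAC ltr_pdivlMr // mul1r -natrM ltr_nat /W expnSr.
  by rewrite mulnDl mul1n -[ltnLHS]addn0 ltn_add2l.
have lp := little_oh_power_path oU Ur b0 ba.
set x := power_path r a in lp.
(* The representative [frep X] may differ from [x], so facts about [x] are transferred through
   [Xx]. *)
pose X : fermat U := \pi_(fermat U)%qT (exist _ x (mem_set lp)).
have Xx : lo_equiv (frep X) x.
  by rewrite /frep /X; case: piP => z /eqmodP/asboolP/lo_equiv_sym.
have X0 : frep X 0 = r by case: Xx => -> _; exact: power_path0.
(* One t^b bounds x(t) - r. The other bounds the difference between [frep X] and [x], which is at
   most t <= t^b since b <= 1. *)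
have hX : \forall t \near (0 : R)^'+, `|frep X t - frep X 0| <= 2 * t `^ b.
  have Xx1 := lo_equiv_near1 Xx.
  near=> t; have t01 : 0 < t <= 1 by near: t; exact: near_right_le1.
  have /andP[t0 t1] := t01.
  rewrite X0 -(subrKA (x t)) (le_trans (ler_normD _ _)) // mulrDl mul1r lerD //.
    apply: (@le_trans _ _ t); first by near: t.
    by rewrite -[leLHS](powRr1 (ltW t0)); apply: ger_powR.
  exact: power_path_holder.
(* Nothing is lost by [inord]: each [K i] is at most the sum of [K], which is below [N]. *)
pose k0 : {ffun 'I_m -> 'I_N.+1} := [ffun i => inord (K i)].
have k0E i : k0 i = K i :> nat.
  rewrite ffunE inordK // ltnS /N (bigD1 i) //= leqW // leq_addr //.
(* The exponent of t in the monomial path of [k]; [c k] below is its coefficient 1/k!. *)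
pose e (k : {ffun 'I_m -> 'I_N.+1}) : R := (weight D (fun i => k i))%:R / W%:R.
have e_inj k : e k = e k0 -> k = k0.
  move=> /(mulIf (invr_neq0 (lt0r_neq0 W0))) /eqP; rewrite eqr_nat => /eqP ek.
  apply/ffunP => i; apply/val_inj.
  by apply: (weight_inj (D := D) _ _ ek) => j; exact: ltn_ord.
have e0 k : 0 <= e k by rewrite divr_ge0.
have e1 : e k0 <= 1.
  rewrite ler_pdivrMr // mul1r ler_nat weight_le //.
  by under eq_bigr do rewrite k0E.
pose c (k : {ffun 'I_m -> 'I_N.+1}) : R := \prod_i (k i)`!%:R^-1.
have c0 : c k0 != 0.
  by apply/prodf_neq0 => i _; rewrite invr_eq0 pnatr_eq0 -lt0n fact_gt0.
have monomE k : lo_equiv (monom_path k (frep X)) (fun t => t `^ e k * c k).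
  apply: lo_equiv_trans (lo_equiv_monom_path k (frepP X) lp Xx) _.
  rewrite (_ : monom_path k x = fun t => t `^ e k * c k); first exact: lo_equiv_refl.
  apply/funext => t; rewrite /monom_path /x power_path0 //.
  rewrite (_ : (fun i => _) = fun i => t `^ a i); last first.
    by apply/funext => i; rewrite power_pathE addrAC subrr add0r.
  rewrite multi_monom_powR => [|i]; last exact: ltW.
  congr (t `^ _ * _); rewrite /e /weight natr_sum mulr_suml.
  by apply: eq_bigr => i _; rewrite natrM mulrC mulrA.
(* Since [e k] differs from [e k0] for every other [k], the coefficient at [e k0] retains only the
   term of [k0]. For K = 0 this exponent is 0 and the coefficient is the standard part. *)
have coefE n : multi_partial K (f n) r = fcoef (e k0) (fermat_ext U (f n) X) / c k0.
  rewrite (fermat_ext_expansion oU (sf n) bN hX) fcoef_sum X0 (bigD1 k0) //= big1 => [|k kk0].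
    rewrite addr0 fcoefZ (fcoef_fclass_powR (e0 k0) _ _ (monomE k0)) ?e0 //.
      rewrite eqxx mul1r mulfK //; congr (multi_partial _ _ _).
      by apply/funext => i; rewrite k0E.
    exact: little_oh_poly_monom (frepP X).
  rewrite fcoefZ (fcoef_fclass_powR (e0 k) _ _ (monomE k)) ?e0 //.
    by case: eqP => [/e_inj/eqP|]; rewrite ?(negPf kk0) // mul0r mulr0.
  exact: little_oh_poly_monom (frepP X).
under eq_fun do rewrite coefE.
apply: is_cvgMr_tmp; apply: cvg_fcoef; first by rewrite e0.
exact: cf.
Unshelve. all: by end_near. Qed.

End Convergence.

Theorem theorem27 (R : realType) :
  additive_hausdorff (euclidean_fermat_real R) /\
  forall (m : nat) (U : set 'rV[R]_m) (f : nat -> 'rV[R]_m -> R),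
    open U -> (forall n, smooth U (f n)) ->
    (pointwise_taylor_cvg U f <->
    pointwise_cvg (euclidean_fermat_real R) [set: fermat U]
      (fun n => fermat_ext U (f n))).
Proof.
split=> [|m U f oU sf].
  by split; [exact: norm_hausdorff|exact: add_continuous|exact: opp_continuous].
split; [exact: taylor_cvg_fermat_cvg|exact: fermat_cvg_taylor_cvg].
Qed.
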